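(* Let $r,s,t\ge 1$ be integers with $k=r+s+t-1\ge 3$. Then, for every $\tau$ in the upper half-plane, \[ \begin{aligned} 0=& \sum_{\substack{i+j=k\\ i,j\ge1}}\binom{i-1}{t-1}\binom{j-1}{s-1}(-1)^{i+r} \bigl(P_{i,j}(\tau)-(-1)^jE_{i+j}(\tau)\bigr) \\ &+ \sum_{\substack{j+h=k\\ j,h\ge1}}\binom{j-1}{r-1}\binom{h-1}{t-1}(-1)^{j+s} \bigl(P_{j,h}(\tau)-(-1)^hE_{j+h}(\tau)\bigr) \\ & + \sum_{\substack{h+i=k\\ h,i\ge1}}\binom{h-1}{s-1}\binom{i-1}{r-1}(-1)^{h+t} \bigl(P_{h,i}(\tau)-(-1)^iE_{h+i}(\tau)\bigr). \end{aligned} \]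
   Context: $\tau$ denotes a variable in the upper half-plane and $q=e^{2\pi\sqrt{-1}\tau}$. For even $k\ge 2$ the Eisenstein series is \[E_k(\tau)=\frac{2}{(k-1)!}\Bigl(-\frac{B_k}{2k}+\sum_{n>0}\sigma_{k-1}(n)q^n\Bigr),\] where $B_k$ is the $k$-th Bernoulli number and $\sigma_{k-1}(n)=\sum_{d\mid n}d^{k-1}$. For odd $k\ge 1$ one sets $E_k(\tau)=0$. The prime $'$ denotes the differential operator $(2\pi\sqrt{-1})^{-1}\,d/d\tau$. For integers $r,s\ge 1$, \[P_{r,s}(\tau)=E_r(\tau)E_s(\tau)+\delta_{r,2}\frac{E_s'(\tau)}{s}+\delta_{s,2}\frac{E_r'(\tau)}{r},\] where $\delta$ is the Kronecker delta. *)

(* Defs.v *)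
From HB Require Import structures.
From mathcomp Require Import all_boot all_order all_algebra.
From mathcomp Require Import all_classical all_reals all_analysis.
From mathcomp Require Import complex.

Set Implicit Arguments.
Unset Strict Implicit.
Unset Printing Implicit Defensive.

Import Order.TTheory GRing.Theory Num.Theory.
Import numFieldNormedType.Exports.

Local Open Scope classical_set_scope.
Local Open Scope ring_scope.
Local Open Scope complex_scope.

(* [:: B_0; ...; B_(n-1)], obtained from the recurrence [bernoulli_rec] below,
   which is the coefficientwise form of x / (e^x - 1) = \sum_n B_n x^n / n!
   (so B_1 = -1/2). *)
Fixpoint bernoulli_seq (n : nat) : seq rat :=
  if n is m.+1 then
    let s := bernoulli_seq m in
    rcons s ((m == 0)%:R - m.+1%:R^-1 * \sum_(j < m) 'C(m.+1, j)%:R * s`_j)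
  else [::].

Definition bernoulli (n : nat) : rat := (bernoulli_seq n.+1)`_n.

Lemma size_bernoulli_seq n : size (bernoulli_seq n) = n.
Proof. by elim: n => //= n IHn; rewrite size_rcons IHn. Qed.

Lemma nth_bernoulli_seq n j : (j < n)%N -> (bernoulli_seq n)`_j = bernoulli j.
Proof.
elim: n => // n IHn; rewrite ltnS leq_eqVlt => /predU1P[-> //|lt_jn].
by rewrite /= nth_rcons size_bernoulli_seq lt_jn IHn.
Qed.

Lemma bernoulli_rec n :
  \sum_(j < n.+1) 'C(n.+1, j)%:R * bernoulli j = (n == 0)%:R.
Proof.
have nz : n.+1%:R != 0 :> rat by rewrite pnatr_eq0.
rewrite big_ord_recr /= binSn {2}/bernoulli /= nth_rcons size_bernoulli_seq.
rewrite ltnn eqxx.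
under [in X in _ + X]eq_bigr => j _ do rewrite nth_bernoulli_seq//.
rewrite mulrBr mulVKf// addrC subrK.
by case: n nz => [|n] _; rewrite ?mulr1 ?mulr0.
Qed.

Definition sigma (m n : nat) : nat := (\sum_(d <- divisors n) d ^ m)%N.

Definition cexp (R : realType) (z : R[i]) : R[i] :=
  (expR (complex.Re z))%:C * (cos (complex.Im z) +i* sin (complex.Im z)).

Definition two_pi_i (R : realType) : R[i] := 0 +i* (2 * pi).

Definition qpar (R : realType) (tau : R[i]) : R[i] := cexp (two_pi_i R * tau).

(* The normed-module structure of R[i] over itself, which carries limits and
   derivatives, is found by the library on R[i]^o, not on R[i]. *)
Definition csum_pos (R : realType) (u : nat -> R[i]) : R[i] :=
  limn (fun N => \sum_(1 <= n < N) u n : R[i]^o).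

(* Meaningful for 1 <= k and tau in the upper half-plane. *)
Definition eisenstein (R : realType) (k : nat) (tau : R[i]) : R[i] :=
  if odd k then 0
  else 2 / (k.-1)`!%:R *
       (- (ratr (bernoulli k) / (2 * k)%:R)
        + csum_pos (fun n => (sigma k.-1 n)%:R * qpar tau ^+ n)).

(* [derive1] is the limit of the difference quotient over increments in R[i],
   i.e. the complex derivative. *)
Definition qderiv (R : realType) (f : R[i] -> R[i]) (tau : R[i]) : R[i] :=
  (two_pi_i R)^-1 * derive1 (f : R[i] -> R[i]^o) tau.

Definition eisensteinP (R : realType) (r s : nat) (tau : R[i]) : R[i] :=
  eisenstein r tau * eisenstein s tau
  + (r == 2)%:R * (qderiv (eisenstein s) tau / s%:R)
  + (s == 2)%:R * (qderiv (eisenstein r) tau / r%:R).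

(* Main.v *)
Require Import Defs.
From HB Require Import structures.
From mathcomp Require Import all_boot all_order all_algebra.
From mathcomp Require Import all_classical all_reals all_analysis.
From mathcomp Require Import complex.
From mathcomp Require Import ring lra zify.

Set Implicit Arguments.
Unset Strict Implicit.
Unset Printing Implicit Defensive.

Import Order.TTheory GRing.Theory Num.Theory.
Import numFieldNormedType.Exports.

Local Open Scope ring_scope.
Local Open Scope complex_scope.

(** The generating function Z(x) = 1/x - \sum_(k >= 2) E_k x^(k-1) equals
    coth(x/2)/2 - \sum_n q^n \sum_(d | n) (e^(dx) - e^(-dx)), and for
    x + y + z = 0 one has
      Z(x)Z(y) + Z(y)Z(z) + Z(z)Z(x) - \sum_k E_k'/k (x^k + y^k + z^k) = 3 E_2.
    In degree K = k - 2 this says that the cyclic sum of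
    \sum_(i+j=k) (P_(i,j) - (-1)^j E_k) x^(i-1) y^(j-1) vanishes.  Putting
    x = U - W, y = V - U, z = W - V and extracting the coefficient of
    U^(r-1) V^(s-1) W^(t-1) gives the binomial identity.

    The relation is proved one coefficient of q^n at a time, over the rationals.
    For n = 0 it is the addition formula of the hyperbolic cotangent.  For n > 0
    the convolutions of divisor sums run over the quadruples of positive integers
    with ab + cd = n and are rearranged by Skoruppa's bijection
    (a,b,c,d) -> (a-c,b,c,b+d); what is left over cancels against the derivative
    terms and the products of Bernoulli numbers with divisor sums. *)

(** * Absolutely convergent series in R[i] *)

(** The weight-k terms [(-1)^j E_k] form geometric sums with denominator x + y = -z; over the cyclic
    sum these are the products of E_k with the polar part 1/x of Z. The products of Bernoulli
    numbers with divisor sums are evaluated by a trapezoidal Bernoulli formula along the progression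
    of step x from d y to -d z. Its interior points match what Skoruppa's bijection leaves on the
    diagonal b = d, and its end points cancel the -1 in the count n/d - 1 on the diagonal a = c; the
    n/d cancels against the derivative terms. All this divides by x, y and z, so the relation is
    obtained at nonzero rationals and becomes an equality of coefficients by evaluation at
    infinitely many integer points. Analysis serves only to produce rational q-expansions:
    polynomial growth of the coefficients allows Cauchy products and termwise differentiation, and
    equal coefficient sequences have equal limits. For odd k every coefficient vanishes by
    parity. *)

Section ComplexAnalysis.
Local Open Scope classical_set_scope.
Local Open Scope ring_scope.
Local Open Scope complex_scope.
Variable R : realType.
Implicit Types (z w q : R[i]) (x y : R).

(** The norm of [R[i]] takes values in [R[i]]; its real part moves all estimates into the ordered
    field [R]. *)
Definition cabs z : R := complex.Re `|z|.

Lemma cabsE z : (cabs z)%:C = `|z|.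
Proof. by rewrite /cabs normc_def. Qed.

Lemma cabs_ge0 z : 0 <= cabs z.
Proof. by rewrite -lecR cabsE normr_ge0. Qed.

Lemma cabsM z w : cabs (z * w) = cabs z * cabs w.
Proof. by apply: (@complexI R); rewrite rmorphM/= !cabsE normrM. Qed.

Lemma cabs0 : cabs 0 = 0.
Proof. by apply: (@complexI R); rewrite cabsE normr0. Qed.

Lemma cabsX z n : cabs (z ^+ n) = cabs z ^+ n.
Proof. by apply: (@complexI R); rewrite rmorphXn/= !cabsE normrX. Qed.

Lemma cabsN z : cabs (- z) = cabs z.
Proof. by apply: (@complexI R); rewrite !cabsE normrN. Qed.

Lemma cabs_eq0 z : (cabs z == 0) = (z == 0).
Proof. by rewrite -(inj_eq (@complexI R)) cabsE normr_eq0. Qed.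

Lemma cabsD z w : cabs (z + w) <= cabs z + cabs w.
Proof. by rewrite -lecR rmorphD/= !cabsE ler_normD. Qed.

Lemma cabs_sum (I : Type) (s : seq I) (P : pred I) (F : I -> R[i]) :
  cabs (\sum_(i <- s | P i) F i) <= \sum_(i <- s | P i) cabs (F i).
Proof.
elim/big_ind2 : _ => [|z x w y hz hw|//]; first by rewrite cabs0.
by rewrite (le_trans (cabsD _ _))// lerD.
Qed.

Lemma cabs_real x : cabs x%:C = `|x|.
Proof. by rewrite /cabs normc_def/= expr0n addr0 sqrtr_sqr. Qed.

Lemma cabs_ratr (c : rat) : cabs (ratr c) = ratr `|c|.
Proof.
have -> : ratr c = (ratr c : R)%:C :> R[i] by rewrite fmorph_rat.
by rewrite cabs_real ratr_norm.
Qed.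

Lemma Re_le_cabs z : `|complex.Re z| <= cabs z.
Proof. by rewrite /cabs normc_def/= -sqrtr_sqr ler_wsqrtr// lerDl sqr_ge0. Qed.

Lemma Im_le_cabs z : `|complex.Im z| <= cabs z.
Proof. by rewrite /cabs normc_def/= -sqrtr_sqr ler_wsqrtr// lerDr sqr_ge0. Qed.

Lemma cabs_le_ReIm z : cabs z <= `|complex.Re z| + `|complex.Im z|.
Proof.
rewrite [in leLHS](complexE z) (le_trans (cabsD _ _))// cabsM !cabs_real.
have -> : cabs 'i%C = 1 by rewrite /cabs normc_def/= expr0n add0r expr1n sqrtr1.
by rewrite mul1r.
Qed.

Lemma cvg_cabs (T : Type) (F : set_system T) {FF : Filter F}
    (u : T -> R[i]^o) (v : T -> R) (l : R[i]^o) :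
  (\forall n \near F, cabs (l - u n) <= v n) ->
  (v @ F --> (0 : R)) -> (u @ F --> l)%classic.
Proof.
move=> uv v0; apply/cvgrPdist_lt => e e0.
have e0' : 0 < complex.Re e by move: e0; rewrite ltcE => /andP[].
(* In the order of [R[i]] a positive element has zero imaginary part. *)
have eE : e = (complex.Re e)%:C.
  by move: e0; rewrite ltcE => /andP[/eqP + _]; case: (e) => a b /= ->.
move/cvgrPdist_lt : v0 => /(_ _ e0') v0.
near=> n.
rewrite eE -[X in X < _]cabsE ltcR (@le_lt_trans _ _ (v n))//.
  by near: n.
rewrite (le_lt_trans (ler_norm _))// -normrN -[- v n]add0r.
by near: n.
Unshelve. all: end_near. Qed.

Lemma cabs_cvg (u : nat -> R[i]^o) (l : R[i]^o) : (u @ \oo --> l) ->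
  forall e : R, 0 < e -> \forall n \near \oo, cabs (l - u n) < e.
Proof.
move=> /cvgrPdist_lt ul e e0.
have /ul : 0 < e%:C :> R[i] by rewrite ltcR.
apply: filterS => n.
by rewrite -[X in X < _]cabsE ltcR.
Qed.

Lemma cabs_cvg_le (u : nat -> R[i]^o) (l : R[i]^o) (B : R) :
  (u @ \oo --> l) -> (forall n, cabs (u n) <= B) -> cabs l <= B.
Proof.
move=> ul uB; apply/ler_addgt0Pr => e e0.
have [n _ /(_ n (leqnn n)) un] := cabs_cvg ul e0.
rewrite -(subrK (u n) l) (le_trans (cabsD _ _))// addrC lerD//.
exact: ltW.
Qed.

(** Real and imaginary parts converge absolutely by comparison with [v], so completeness is only
    used in [R]. *)
Lemma cabs_series_cvg (u : nat -> R[i]) (v : nat -> R) :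
  (forall n, cabs (u n) <= v n) -> cvgn (series v) ->
  exists l : R[i], ((fun N => \sum_(0 <= n < N) u n : R[i]^o) @ \oo --> (l : R[i]^o)).
Proof.
move=> uv cv.
have v0 n : 0 <= v n by exact: le_trans (cabs_ge0 _) (uv n).
have c1 : cvgn (series (fun n => complex.Re (u n))).
  apply: normed_cvg; apply: (@series_le_cvg _ _ v) => // n /=.
    exact: normr_ge0.
  exact: le_trans (Re_le_cabs _) (uv n).
have c2 : cvgn (series (fun n => complex.Im (u n))).
  apply: normed_cvg; apply: (@series_le_cvg _ _ v) => // n /=.
    exact: normr_ge0.
  exact: le_trans (Im_le_cabs _) (uv n).
move/cvg_ex : c1 => [a ca]; move/cvg_ex : c2 => [b cb].
exists (a +i* b).
apply: (@cvg_cabs _ _ _ _ (fun N => `|a - series (fun n => complex.Re (u n)) N| +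
          `|b - series (fun n => complex.Im (u n)) N|)).
  near=> N.
  have <- : complex.Re ((a +i* b) - \sum_(0 <= n < N) u n) = a - series (fun n => complex.Re (u n)) N.
    by rewrite raddfB/= raddf_sum.
  have <- : complex.Im ((a +i* b) - \sum_(0 <= n < N) u n) = b - series (fun n => complex.Im (u n)) N.
    by rewrite raddfB/= raddf_sum.
  exact: cabs_le_ReIm.
rewrite -[X in _ --> X](addr0 0).
apply: cvgD; rewrite -(normr0 R); apply: cvg_norm.
  by rewrite -[X in _ --> X](subrr a); apply: cvgB => //; exact: cvg_cst.
by rewrite -[X in _ --> X](subrr b); apply: cvgB => //; exact: cvg_cst.
Unshelve. all: end_near. Qed.

(** With t = r/r' < 1, t^n is the smallest of the first n+1 powers of t, so (n+1) t^n is at most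
    their sum, hence at most 1/(1-t). *)
Lemma natM_expr_bound (r r' : R) : 0 <= r -> r < r' ->
  exists C : R, 0 <= C /\ forall n, n.+1%:R * r ^+ n <= C * r' ^+ n.
Proof.
move=> r0 rr'; have r'0 : 0 < r' by exact: le_lt_trans rr'.
pose t := r / r'; have t0 : 0 <= t by rewrite divr_ge0// ltW.
have t1 : t < 1 by rewrite ltr_pdivrMr// mul1r.
exists (1 - t)^-1; split; first by rewrite invr_ge0 subr_ge0 ltW.
move=> n; have -> : r = t * r' by rewrite divfK// gt_eqF.
rewrite exprMn mulrA; apply: ler_wpM2r; first by rewrite exprn_ge0// ltW.
have -> : n.+1%:R * t ^+ n = \sum_(i < n.+1) t ^+ n.
  by rewrite sumr_const card_ord mulr_natl.
have : \sum_(i < n.+1) t ^+ n <= \sum_(i < n.+1) t ^+ i.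
  by apply: ler_sum => i _; apply: ler_wiXn2l => //; [exact: ltW | exact: (ltn_ord i)].
move=> h; apply: (le_trans h).
rewrite -[leRHS]mul1r ler_pdivlMr ?subr_gt0// mulrC -opprB mulNr -subrX1 opprB.
by rewrite lerBlDr lerDl exprn_ge0.
Qed.



(** Each factor n+1 is absorbed by a slight increase of the ratio; the midpoint [s] leaves room for
    the remaining factors. *)
Lemma polyM_expr_bound m (r r' : R) : 0 <= r -> r < r' ->
  exists2 C : R, 0 <= C & forall n, n.+1%:R ^+ m * r ^+ n <= C * r' ^+ n.
Proof.
elim: m r => [|m IH] r r0 rr'.
  exists 1 => // n; rewrite expr0 !mul1r lerXn2r// ?nnegrE//.
    by rewrite (le_trans r0)// ltW.
  exact: ltW.
pose s := (r + r') / 2.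
have rs : r < s by rewrite midf_lt.
have sr' : s < r' by rewrite midf_lt.
have [C [C0 hC]] := natM_expr_bound r0 rs.
have [D D0 hD] := IH s (le_trans r0 (ltW rs)) sr'.
exists (C * D); first exact: mulr_ge0.
move=> n; rewrite exprSr -mulrA.
apply: (@le_trans _ _ (n.+1%:R ^+ m * (C * s ^+ n))).
  by rewrite ler_wpM2l// exprn_ge0.
by rewrite mulrCA -mulrA ler_wpM2l.
Qed.

(** The base [n.+1] lets the bound hold at [n = 0] for a nonzero constant term. *)
Definition poly_growth (a : nat -> rat) :=
  exists m C, forall n, `|a n| <= C * n.+1%:R ^+ m.

Lemma poly_growthM a b : poly_growth a -> poly_growth b ->
  poly_growth (fun n => a n * b n).
Proof.
move=> [m [C hC]] [m' [C' hC']]; exists (m + m')%N, (C * C') => n.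
by rewrite exprD mulrACA normrM ler_pM.
Qed.

Lemma poly_growth_nat : poly_growth (fun n => n%:R).
Proof. by exists 1%N, 1 => n; rewrite mul1r expr1 normr_nat ler_nat. Qed.

Lemma poly_growth_bound a (r r' : R) : poly_growth a -> 0 <= r -> r < r' ->
  exists2 C : R, 0 <= C & forall n, cabs (ratr (a n)) * r ^+ n <= C * r' ^+ n.
Proof.
move=> [m [C hC]] r0 rr'; have [D D0 hD] := polyM_expr_bound m r0 rr'.
have C0 : 0 <= C by have := hC 0; rewrite expr1n mulr1; apply: le_trans.
exists (ratr C * D); first by rewrite mulr_ge0// ler0q.
move=> n; apply: (@le_trans _ _ (ratr (C * n.+1%:R ^+ m) * r ^+ n)).
  by rewrite ler_wpM2r ?exprn_ge0// cabs_ratr ler_rat.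
have : 0 <= ratr C :> R by rewrite ler0q.
rewrite rmorphM rmorphXn/= ratr_nat; move: (ratr C) => c c0.
by rewrite -!mulrA ler_wpM2l.
Qed.

Lemma cvg_addc (u v : nat -> R[i]^o) (l m : R[i]^o) :
  u @ \oo --> l -> v @ \oo --> m -> (fun n => u n + v n) @ \oo --> l + m.
Proof. by move=> hu hv; apply: cvgD; [exact: hu | exact: hv]. Qed.

Lemma cvg_mulcl (c : R[i]) (u : nat -> R[i]) (l : R[i]) :
  (u : nat -> R[i]^o) @ \oo --> (l : R[i]^o) ->
  ((fun n => c * u n : R[i]) : nat -> R[i]^o) @ \oo --> ((c * l : R[i]) : R[i]^o).
Proof. by move=> hu; exact: (@cvgZl_tmp R[i] R[i]^o nat _ _ c u l hu). Qed.

Definition qpsum (q : R[i]) (a : nat -> rat) (N : nat) : R[i] :=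
  \sum_(0 <= n < N) ratr (a n) * q ^+ n.

(** Since the coefficients are rational and the value is a limit, an identity between values follows
    from an identity of sequences in [rat]. *)
Definition qexp (q : R[i]) (a : nat -> rat) (v : R[i]) :=
  (qpsum q a : nat -> R[i]^o) @ \oo --> (v : R[i]^o).

Lemma eq_qexp q a b v : a =1 b -> qexp q a v -> qexp q b v.
Proof. by move=> /funext ->. Qed.

Lemma qexp0 q : qexp q (fun=> 0) 0.
Proof.
rewrite /qexp.
have -> : qpsum q (fun=> 0) = fun=> 0.
  by apply/funext => N; rewrite /qpsum big1// => n _; rewrite rmorph0 mul0r.
exact: cvg_cst.
Qed.

Lemma qexpD q a b v w : qexp q a v -> qexp q b w ->
  qexp q (fun n => a n + b n) (v + w).
Proof.
move=> ha hb; rewrite /qexp.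
have -> : qpsum q (fun n => a n + b n) = fun N => qpsum q a N + qpsum q b N.
  apply/funext => N; rewrite /qpsum -big_split/=.
  by apply: eq_bigr => n _; rewrite rmorphD mulrDl.
exact: (cvg_addc ha hb).
Qed.

Lemma qexpZ q a v c : qexp q a v -> qexp q (fun n => c * a n) (ratr c * v).
Proof.
move=> ha; rewrite /qexp.
have -> : qpsum q (fun n => c * a n) = fun N => ratr c * qpsum q a N.
  apply/funext => N; rewrite /qpsum mulr_sumr.
  by apply: eq_bigr => n _; rewrite rmorphM mulrA.
exact: (@cvg_mulcl (ratr c) _ _ ha).
Qed.

Lemma qexp_sum q (I : Type) (s : seq I) (P : pred I) (a : I -> nat -> rat) v :
  (forall i, P i -> qexp q (a i) (v i)) ->
  qexp q (fun n => \sum_(i <- s | P i) a i n) (\sum_(i <- s | P i) v i).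
Proof.
move=> h; elim: s => [|i s IH].
  by rewrite big_nil; apply: eq_qexp (qexp0 q) => n; rewrite big_nil.
rewrite big_cons; case: ifPn => Pi.
  by apply: eq_qexp (qexpD (h i Pi) IH) => n; rewrite big_cons Pi.
by apply: eq_qexp IH => n; rewrite big_cons (negbTE Pi).
Qed.

Lemma qexp_unique q a v w : qexp q a v -> qexp q a w -> v = w.
Proof. exact: (@cvg_unique R[i]^o). Qed.

Lemma qexp_cvg q a : poly_growth a -> cabs q < 1 -> exists v, qexp q a v.
Proof.
move=> ag q1; pose s := (cabs q + 1) / 2.
have qs : cabs q < s by rewrite midf_lt.
have s1 : s < 1 by rewrite midf_lt.
have [C C0 hC] := poly_growth_bound ag (cabs_ge0 q) qs.
apply: (@cabs_series_cvg _ (geometric C s)) => [n|].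
  by rewrite cabsM cabsX.
apply: is_cvg_geometric_series; rewrite ger0_norm//.
by rewrite (le_trans (cabs_ge0 q))// ltW.
Qed.

End ComplexAnalysis.

(** * Cauchy products of q-expansions *)

Section CauchyProduct.
Variable R : realType.
Local Open Scope classical_set_scope.
Local Open Scope ring_scope.
Local Open Scope complex_scope.

Definition conv (a b : nat -> rat) (n : nat) : rat :=
  \sum_(0 <= l < n.+1) a l * b (n - l)%N.

Lemma sum_triangle (V : nmodType) (f : nat -> nat -> V) N :
  \sum_(0 <= n < N) \sum_(0 <= l < n.+1) f l (n - l)%N =
  \sum_(0 <= i < N) \sum_(0 <= j < N - i) f i j.
Proof.
elim: N => [|N IH]; first by rewrite !big_geq.
rewrite !big_nat_recr//= IH subSnn big_nat1 subnn addrA; congr (_ + _).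
rewrite -big_split/= !big_nat; apply: eq_bigr => i /= iN.
by rewrite subSn ?big_nat_recr// ltnW.
Qed.

Lemma cvg_mulc (u v : nat -> R[i]) (l m : R[i]) :
  (u : nat -> R[i]^o) @ \oo --> (l : R[i]^o) ->
  (v : nat -> R[i]^o) @ \oo --> (m : R[i]^o) ->
  ((fun n => u n * v n : R[i]) : nat -> R[i]^o) @ \oo --> ((l * m : R[i]) : R[i]^o).
Proof. by move=> hu hv; exact: (@cvgZ R[i] R[i]^o nat _ _ u v l m hu hv). Qed.

Lemma cvg_subc (u v : nat -> R[i]) (l m : R[i]) :
  (u : nat -> R[i]^o) @ \oo --> (l : R[i]^o) ->
  (v : nat -> R[i]^o) @ \oo --> (m : R[i]^o) ->
  ((fun n => u n - v n : R[i]) : nat -> R[i]^o) @ \oo --> ((l - m : R[i]) : R[i]^o).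
Proof. by move=> hu hv; exact: (@cvgB R[i] R[i]^o nat _ _ u v l m hu hv). Qed.

Lemma qpsum_conv (q : R[i]) a b N :
  qpsum q (conv a b) N = qpsum q a N * qpsum q b N -
    \sum_(0 <= i < N) \sum_(N - i <= j < N)
      (ratr (a i) * q ^+ i) * (ratr (b j) * q ^+ j).
Proof.
pose f i j := (ratr (a i) * q ^+ i) * (ratr (b j) * q ^+ j).
rewrite -[RHS]/(_ - \sum_(0 <= i < N) \sum_(N - i <= j < N) f i j).
have -> : qpsum q (conv a b) N =
    \sum_(0 <= n < N) \sum_(0 <= l < n.+1) f l (n - l)%N.
  rewrite /qpsum; apply: eq_bigr => n _; rewrite /conv rmorph_sum mulr_suml.
  rewrite !big_nat; apply: eq_bigr => l /= ln.
  by rewrite rmorphM /f [RHS]mulrACA -exprD subnKC.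
rewrite sum_triangle /qpsum mulr_suml -sumrB; apply: eq_bigr => i _.
rewrite mulr_sumr (big_cat_nat (leq0n (N - i)) (leq_subr i N))/=.
by rewrite addrK.
Qed.

(** The defect [D N] collects the pairs i, j < N with i + j >= N. There are at most N^2 of them,
    each of size at most A B s^N, and N^2 s^N tends to 0. *)
Lemma qexpM (q : R[i]) a b v w : poly_growth a -> poly_growth b -> cabs q < 1 ->
  qexp q a v -> qexp q b w -> qexp q (conv a b) (v * w).
Proof.
move=> ga gb q1 ha hb; rewrite /qexp.
pose D N := \sum_(0 <= i < N) \sum_(N - i <= j < N)
      (ratr (a i) * q ^+ i) * (ratr (b j) * q ^+ j).
have -> : qpsum q (conv a b) = fun N => qpsum q a N * qpsum q b N - D N.
  by apply/funext => N; exact: qpsum_conv.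
suff hD : (D : nat -> R[i]^o) @ \oo --> ((0 : R[i]) : R[i]^o).
  by have := cvg_subc (cvg_mulc ha hb) hD; rewrite subr0.
pose s := (cabs q + 1) / 2.
have qs : cabs q < s by rewrite midf_lt.
have s1 : s < 1 by rewrite midf_lt.
have s0 : 0 <= s by rewrite (le_trans (cabs_ge0 q))// ltW.
pose t := (s + 1) / 2.
have st : s < t by rewrite midf_lt.
have t1 : t < 1 by rewrite midf_lt.
have [A A0 hA] := poly_growth_bound ga (cabs_ge0 q) qs.
have [B B0 hB] := poly_growth_bound gb (cabs_ge0 q) qs.
have [E E0 hE] := polyM_expr_bound 2 s0 st.
apply: (@cvg_cabs R _ _ _ _ (geometric (A * B * E) t)); last first.
  by apply: cvg_geometric; rewrite ger0_norm// (le_trans s0)// ltW.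
near=> N; rewrite sub0r cabsN /=.
apply: (@le_trans _ _ (\sum_(0 <= i < N) \sum_(0 <= j < N) A * B * s ^+ N)).
  apply: le_trans (cabs_sum _ _ _) _.
  apply: ler_sum_nat => i iN.
  rewrite [leRHS](big_cat_nat (leq0n (N - i)) (leq_subr i N))/=.
  rewrite -[leLHS]add0r lerD//.
    by apply: sumr_ge0 => j _; rewrite !mulr_ge0// exprn_ge0.
  apply: le_trans (cabs_sum _ _ _) _.
  apply: ler_sum_nat => j /andP[jN _].
  rewrite cabsM (cabsM _ (q ^+ i)) (cabsM _ (q ^+ j)) !cabsX.
  apply: (@le_trans _ _ ((A * s ^+ i) * (B * s ^+ j))).
    by apply: ler_pM => //; apply: mulr_ge0; rewrite ?exprn_ge0 ?cabs_ge0.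
  rewrite mulrACA -exprD ler_wpM2l ?mulr_ge0//.
  by apply: ler_wiXn2l => //; [exact: ltW | rewrite -leq_subLR].
rewrite !sumr_const_nat subn0 -[leLHS]mulr_natl -[X in _ * X]mulr_natl mulrA.
rewrite -expr2 mulrCA -[leRHS]mulrA ler_wpM2l ?mulr_ge0//.
apply: le_trans (hE N); rewrite ler_wpM2r ?exprn_ge0// lerXn2r ?nnegrE//.
by rewrite ler_nat.
Unshelve. all: end_near. Qed.

End CauchyProduct.

(** * Complex exponential *)

Section ExponentialBounds.
Variable R : realType.
Local Open Scope classical_set_scope.
Local Open Scope ring_scope.
Local Open Scope complex_scope.
Implicit Types (x y : R) (w : R[i]).

(** This is 1 - x <= exp(-x) multiplied by exp(x). *)
Lemma expR_sub1_le x : expR x - 1 <= x * expR x.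
Proof.
have := expR_ge1Dx (- x); rewrite -(ler_pM2r (expR_gt0 x)) -expRD addNr expR0.
by lra.
Qed.

Lemma norm_expR_sub1 x : `|expR x - 1| <= `|x| * expR `|x|.
Proof.
have h1 := expR_ge1Dx x; have h2 := expR_sub1_le x.
have [x0|x0] := leP 0 x.
  by rewrite !ger0_norm//; lra.
have h3 : 1 <= expR (- x) by rewrite -expR0 ler_expR; lra.
rewrite (ltr0_norm x0) ler0_norm; last by rewrite subr_le0 expR_le1 ltW.
have : - x * 1 <= - x * expR (- x) by rewrite ler_wpM2l//; lra.
by lra.
Qed.

(** The quantity lies between 0 and x (exp x - 1), by the two first-order bounds. *)
Lemma norm_expR_sub1x x : `|expR x - 1 - x| <= x ^+ 2 * expR `|x|.
Proof.
have h1 := expR_ge1Dx x; have h2 := expR_sub1_le x.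
rewrite ger0_norm; last by lra.
rewrite (@le_trans _ _ (x * (expR x - 1)))//; first by lra.
rewrite (le_trans (ler_norm _))// normrM -real_normK ?num_real// expr2 -mulrA.
by rewrite ler_wpM2l// norm_expR_sub1.
Qed.

Lemma sin_le x : 0 <= x -> `|sin x| <= x.
Proof.
move=> x0.
have [|c _] := @MVT_segment R sin cos 0 x x0 (fun y _ => is_derive_sin y).
  by apply: continuous_subspaceT => y; exact: continuous_sin.
rewrite sin0 !subr0 => ->; rewrite normrM (ger0_norm x0) ler_piMl//.
exact: cos_max.
Qed.

Lemma norm_sin_le x : `|sin x| <= `|x|.
Proof.
have [x0|x0] := leP 0 x; first by rewrite (ger0_norm x0) sin_le.
by rewrite -normrN -sinN (ltr0_norm x0) sin_le// oppr_ge0 ltW.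
Qed.

Lemma one_sub_cos x : 1 - cos x = 2 * sin (x / 2) ^+ 2.
Proof.
have {1}-> : x = x / 2 + x / 2 by lra.
by rewrite cosD -!expr2 cos2sin2; lra.
Qed.

Lemma norm_cos_sub1_sqr x : `|cos x - 1| <= x ^+ 2.
Proof.
have h := norm_sin_le (x / 2).
rewrite distrC one_sub_cos ger0_norm; last by rewrite mulr_ge0// sqr_ge0.
have : sin (x / 2) ^+ 2 <= (x / 2) ^+ 2.
  by rewrite -[leLHS]real_normK ?num_real// -[leRHS]real_normK ?num_real// lerXn2r ?nnegrE.
have := sqr_ge0 x; rewrite !expr2; lra.
Qed.

Lemma norm_cos_sub1 x : `|cos x - 1| <= `|x|.
Proof.
have h := norm_sin_le (x / 2).
rewrite distrC one_sub_cos ger0_norm; last by rewrite mulr_ge0// sqr_ge0.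
rewrite -real_normK ?num_real// expr2.
have : `|sin (x / 2)| * `|sin (x / 2)| <= `|sin (x / 2)| * 1.
  by rewrite ler_wpM2l// sin_max.
move: h; rewrite normrM (@ger0_norm _ 2^-1)//; lra.
Qed.

(** By the mean value theorem the quotient by x is cos c - 1 with 0 < c < x, of absolute value at
    most c. *)
Lemma sin_sub_le x : 0 <= x -> `|sin x - x| <= x ^+ 2.
Proof.
move=> x0.
have d y : y \in `]0, x[ -> is_derive y 1 (fun y => sin y - y) (cos y - 1).
  by move=> _; apply: is_deriveB.
have [|c cx] := @MVT_segment R (fun y => sin y - y) (fun y => cos y - 1) 0 x x0 d.
  apply: continuous_subspaceT => y; apply: cvgB; first exact: continuous_sin.
  exact: cvg_id.
rewrite sin0 !subr0 => ->; rewrite normrM (ger0_norm x0) expr2 ler_wpM2r//.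
rewrite (le_trans (norm_cos_sub1 _))//; move: cx; rewrite in_itv/= => /andP[c0 cx].
by rewrite ger0_norm.
Qed.

Lemma norm_sin_sub x : `|sin x - x| <= x ^+ 2.
Proof.
have [x0|x0] := leP 0 x; first by rewrite sin_sub_le.
have -> : sin x - x = - (sin (- x) - (- x)) by rewrite sinN; ring.
by rewrite normrN -sqrrN sin_sub_le// oppr_ge0 ltW.
Qed.

(** The constant 4 counts the pieces [b1] to [b4], two from the real and two from the imaginary
    part. The factor [expR (cabs w)] makes the bound hold for every w, as it is applied to w = 2 pi
    i n h with n unbounded. *)
Lemma cabs_cexp_sub1x w :
  cabs (cexp w - 1 - w) <= 4 * cabs w ^+ 2 * expR (cabs w).
Proof.
case: w => x y; set r := cabs (x +i* y).
have hx : `|x| <= r by exact: (Re_le_cabs (x +i* y)).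
have hy : `|y| <= r by exact: (Im_le_cabs (x +i* y)).
have r0 : 0 <= r by rewrite cabs_ge0.
have er : expR `|x| <= expR r by rewrite ler_expR.
have ex : expR x <= expR r by rewrite ler_expR (le_trans (ler_norm _)).
have x2 : x ^+ 2 <= r ^+ 2 by rewrite -real_normK ?num_real// lerXn2r ?nnegrE.
have y2 : y ^+ 2 <= r ^+ 2 by rewrite -real_normK ?num_real// lerXn2r ?nnegrE.
have e0 := expR_ge0 x; have e0' := expR_ge0 `|x|.
apply: (le_trans (cabs_le_ReIm _)).
rewrite /cexp; simpc => /=.
have -> : expR x * cos y - 1 - x = (expR x - 1 - x) + expR x * (cos y - 1) by ring.
have -> : expR x * sin y - y = expR x * (sin y - y) + y * (expR x - 1) by ring.
have b1 : `|expR x - 1 - x| <= r ^+ 2 * expR r.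
  by rewrite (le_trans (norm_expR_sub1x x))// ler_pM// sqr_ge0.
have b2 : `|expR x * (cos y - 1)| <= r ^+ 2 * expR r.
  rewrite normrM (ger0_norm e0) mulrC ler_pM//.
  exact: le_trans (norm_cos_sub1_sqr y) _.
have b3 : `|expR x * (sin y - y)| <= r ^+ 2 * expR r.
  rewrite normrM (ger0_norm e0) mulrC ler_pM//.
  exact: le_trans (norm_sin_sub y) _.
have b4 : `|y * (expR x - 1)| <= r ^+ 2 * expR r.
  rewrite normrM expr2 -mulrA ler_pM//.
  by rewrite (le_trans (norm_expR_sub1 x))// ler_pM.
have := ler_normD (expR x - 1 - x) (expR x * (cos y - 1)).
have := ler_normD (expR x * (sin y - y)) (y * (expR x - 1)).
lra.
Qed.

Lemma cexpD (w1 w2 : R[i]) : cexp (w1 + w2) = cexp w1 * cexp w2.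
Proof.
case: w1 w2 => [x1 y1] [x2 y2]; rewrite /cexp; simpc => /=.
rewrite expRD cosD sinD; congr (_ +i* _); ring.
Qed.

Lemma cexp0 : cexp (0 : R[i]) = 1.
Proof. by rewrite /cexp /= expR0 cos0 sin0 mul1r. Qed.

Lemma cexpMn (w : R[i]) n : cexp (n%:R * w) = cexp w ^+ n.
Proof.
elim: n => [|n IH]; first by rewrite mul0r cexp0.
by rewrite -natr1 mulrDl mul1r cexpD IH exprSr.
Qed.

Lemma cabs_cexp (w : R[i]) : cabs (cexp w) = expR (complex.Re w).
Proof.
rewrite /cexp cabsM cabs_real ger0_norm ?expR_ge0//.
by rewrite /cabs normc_def/= cos2Dsin2 sqrtr1 mulr1.
Qed.

End ExponentialBounds.

(** * q-expansions and their derivatives *)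

Section QDerivative.
Variable R : realType.
Local Open Scope classical_set_scope.
Local Open Scope ring_scope.
Local Open Scope complex_scope.
Implicit Types tau : R[i].

Lemma cabs_two_pi_i : cabs (two_pi_i R) = 2 * pi.
Proof.
rewrite /cabs normc_def/= expr0n add0r sqrtr_sqr ger0_norm//.
by rewrite mulr_ge0// pi_ge0.
Qed.

Lemma two_pi_i_neq0 : two_pi_i R != 0.
Proof. by rewrite -cabs_eq0 cabs_two_pi_i mulf_neq0// gt_eqF// pi_gt0. Qed.

Lemma cabs_qpar tau : cabs (qpar tau) = expR (- (2 * pi * complex.Im tau)).
Proof. by case: tau => x y; rewrite /qpar cabs_cexp /two_pi_i; simpc. Qed.

Lemma cabs_qpar_lt1 tau : 0 < complex.Im tau -> cabs (qpar tau) < 1.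
Proof.
by move=> t0; rewrite cabs_qpar expR_lt1 oppr_lt0 !mulr_gt0// pi_gt0.
Qed.

Lemma near0_cabs_lt (e : R) : 0 < e -> \forall h \near (0 : R[i]^o)^', cabs h < e.
Proof.
move=> e0; have e0' : 0 < e%:C :> R[i] by rewrite ltcR.
apply: filterS (@dnbhs0_lt _ R[i]^o _ e0') => h.
by rewrite -[X in X < _]cabsE ltcR.
Qed.

Lemma cvg_mul_cabs (M : R) : (fun h : R[i]^o => M * cabs h) @ (0 : R[i]^o)^' --> (0 : R).
Proof.
apply/cvgrPdist_lt => e e0.
have M0 : 0 < `|M| + 1 by rewrite ltr_wpDl.
near=> h; rewrite sub0r normrN normrM (ger0_norm (cabs_ge0 h)).
have : cabs h < e / (`|M| + 1) by near: h; apply: near0_cabs_lt; exact: divr_gt0.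
rewrite ltr_pdivlMr// mulrDr mulr1 mulrC => hh.
by rewrite (le_lt_trans _ hh)// lerDl cabs_ge0.
Unshelve. all: end_near. Qed.

Lemma qpsum_shift (a : nat -> rat) tau (h : R[i]) N :
  qpsum (qpar (h + tau)) a N - qpsum (qpar tau) a N
    - h * two_pi_i R * qpsum (qpar tau) (fun n => n%:R * a n) N =
  \sum_(0 <= n < N) ratr (a n) * qpar tau ^+ n *
     (cexp (n%:R * (two_pi_i R * h)) - 1 - n%:R * (two_pi_i R * h)).
Proof.
rewrite /qpsum mulr_sumr -!sumrB; apply: eq_bigr => n _.
rewrite cexpMn {1}/qpar mulrDr cexpD exprMn -/(qpar tau) rmorphM/= ratr_nat.
ring.
Qed.

(** The second-order remainder of the exponential brings out n^2 |h|^2; the n^2 goes into the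
    coefficients [b], still of polynomial growth. That [M] depends on neither [h] nor [N] is what
    permits termwise differentiation. *)
Lemma qpsum_shift_bound (a : nat -> rat) tau : poly_growth a ->
  0 < complex.Im tau -> exists M, forall h : R[i], cabs h < complex.Im tau / 2 ->
  forall N, cabs (\sum_(0 <= n < N) ratr (a n) * qpar tau ^+ n *
     (cexp (n%:R * (two_pi_i R * h)) - 1 - n%:R * (two_pi_i R * h)))
  <= M * cabs h ^+ 2.
Proof.
move=> ga t0; set T := 2 * pi : R.
have T0 : 0 <= T by rewrite mulr_ge0// pi_ge0.
(* [s] is the square root of |q|: for |h| < Im tau / 2 the factor exp(2 pi n |h|) uses up at most
   half of the decay of |q|^n. *)
pose s : R := expR (- (pi * complex.Im tau)).
have s0 : 0 <= s by exact: expR_ge0.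
have s1 : s < 1 by rewrite expR_lt1 oppr_lt0 mulr_gt0// pi_gt0.
pose t := (s + 1) / 2.
have st : s < t by rewrite midf_lt.
have t1 : t < 1 by rewrite midf_lt.
have tg0 : 0 < t by exact: le_lt_trans st.
pose b n := n%:R * (n%:R * a n).
have gb : poly_growth b.
  by apply: poly_growthM poly_growth_nat _; apply: poly_growthM poly_growth_nat _.
have [C C0 hC] := poly_growth_bound gb s0 st.
exists (4 * T ^+ 2 * (C / (1 - t))) => h hh N.
have ch0 := cabs_ge0 h.
apply: le_trans (cabs_sum _ _ _) _.
apply: (@le_trans _ _ (\sum_(0 <= n < N) 4 * T ^+ 2 * cabs h ^+ 2 * (C * t ^+ n))).
  apply: ler_sum_nat => n _.
  have cn : cabs (n%:R * (two_pi_i R * h)) = n%:R * (T * cabs h).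
    by rewrite cabsM cabsM cabs_two_pi_i -[n%:R](ratr_nat R[i]) cabs_ratr normr_nat ratr_nat.
  rewrite cabsM (cabsM (ratr _)) cabsX.
  apply: (@le_trans _ _ (cabs (ratr (a n) : R[i]) * cabs (qpar tau) ^+ n *
     (4 * (n%:R * (T * cabs h)) ^+ 2 * expR (n%:R * (T * cabs h))))).
    apply: ler_wpM2l; first by rewrite mulr_ge0 ?exprn_ge0 ?cabs_ge0.
    by rewrite -cn; exact: cabs_cexp_sub1x.
  have qs : cabs (qpar tau) ^+ n * expR (n%:R * (T * cabs h)) <= s ^+ n.
    rewrite cabs_qpar -!expRM_natl -expRD ler_expR -mulrDr ler_wpM2l//.
    have : pi * cabs h <= pi * (complex.Im tau / 2).
      by rewrite ler_wpM2l ?pi_ge0// ltW.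
    by rewrite /T; lra.
  have bn : cabs (ratr (b n) : R[i]) = n%:R ^+ 2 * cabs (ratr (a n) : R[i]).
    by rewrite !cabs_ratr /b !normrM !normr_nat !rmorphM/= !ratr_nat mulrA expr2.
  apply: le_trans (_ : 4 * T ^+ 2 * cabs h ^+ 2 * (cabs (ratr (b n) : R[i]) * s ^+ n) <= _).
    rewrite bn; move: (cabs (ratr _)) (cabs_ge0 (ratr (a n) : R[i])) => A A0.
    move: qs; set Q := _ ^+ n; set E := expR _; set S := s ^+ n => qs.
    rewrite [leLHS](_ : _ = 4 * T ^+ 2 * cabs h ^+ 2 * n%:R ^+ 2 * A * (Q * E));
      last by ring.
    rewrite [leRHS](_ : _ = 4 * T ^+ 2 * cabs h ^+ 2 * n%:R ^+ 2 * A * S);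
      last by ring.
    by rewrite ler_wpM2l// !mulr_ge0// pi_ge0.
  by apply: ler_wpM2l => //; rewrite !mulr_ge0// pi_ge0.
rewrite -mulr_sumr [leRHS](_ : _ = 4 * T ^+ 2 * cabs h ^+ 2 * (C / (1 - t)));
  last by ring.
apply: ler_wpM2l; first by rewrite !mulr_ge0// pi_ge0.
by apply: geometric_le_lim => //; rewrite ger0_norm// ltW.
Qed.

(** The remainder bound is uniform in the number of terms, so it passes to the limit: F(tau + h) -
    F(tau) - 2 pi i h v is at most M |h|^2, and division by h leaves M |h|. *)
Lemma qexp_deriv (a : nat -> rat) (F : R[i] -> R[i]) tau : poly_growth a ->
  (forall t : R[i], 0 < complex.Im t -> qexp (qpar t) a (F t)) ->
  0 < complex.Im tau -> qexp (qpar tau) (fun n => n%:R * a n) (qderiv F tau).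
Proof.
move=> ga hF t0.
have [v hv] := qexp_cvg (poly_growthM poly_growth_nat ga) (cabs_qpar_lt1 t0).
have [M hM] := qpsum_shift_bound ga t0.
suff -> : qderiv F tau = v by [].
rewrite /qderiv; suff -> : derive1 (F : R[i] -> R[i]^o) tau = two_pi_i R * v.
  by rewrite mulKf// two_pi_i_neq0.
apply: (@cvg_lim R[i]^o (@norm_hausdorff _ _)).
apply: (@cvg_cabs R _ _ _ _ (fun h : R[i]^o => M * cabs h)); last first.
  exact: cvg_mul_cabs.
near=> h.
have h0 : h != 0 by near: h; exact: (@nbhs_dnbhs_neq R[i]^o 0).
have hh : cabs h < complex.Im tau / 2 by near: h; apply: near0_cabs_lt; exact: divr_gt0.
have ht : 0 < complex.Im (h + tau).
  have := le_lt_trans (Im_le_cabs h) hh; rewrite ltr_norml raddfD/= => /andP[]; lra.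
have hc : cabs h != 0 by rewrite cabs_eq0.
have ch : 0 < cabs h by rewrite lt_neqAle eq_sym hc cabs_ge0.
have := @cvg_mulcl R (h * two_pi_i R) _ _ hv.
move/(cvg_subc (cvg_subc (hF _ ht) (hF _ t0)))/cabs_cvg_le => /(_ (M * cabs h ^+ 2)).
have hN : forall N, cabs (qpsum (qpar (h + tau)) a N - qpsum (qpar tau) a N
    - h * two_pi_i R * qpsum (qpar tau) (fun n => n%:R * a n) N) <= M * cabs h ^+ 2.
  by move=> N; rewrite qpsum_shift; exact: hM.
move=> /(_ hN) {hN} H.
rewrite -(ler_pM2l ch) -cabsM.
have -> : h * (two_pi_i R * v - h^-1 *: (F (h + tau) - F tau : R[i]^o)) =
   - (F (h + tau) - F tau - h * two_pi_i R * v).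
  by rewrite mulrBr -[h^-1 *: _]/(h^-1 * (F (h + tau) - F tau : R[i])) mulVKf// [RHS]opprB mulrA.
by rewrite cabsN mulrCA -expr2.
Unshelve. all: end_near. Qed.

(** The constant term is 2/(k-1)! times -B_k/(2k), that is -B_k/k!. *)
Definition eis_coef (k n : nat) : rat :=
  if odd k then 0
  else if n == 0%N then - (bernoulli k / k`!%:R)
  else 2 * (sigma k.-1 n)%:R / (k.-1)`!%:R.

Lemma sigmaE m n : (0 < n)%N ->
  sigma m n = (\sum_(1 <= d < n.+1 | (d %| n)%N) d ^ m)%N.
Proof.
move=> n0; rewrite /sigma -[RHS]big_filter; apply: perm_big.
apply: uniq_perm; rewrite ?divisors_uniq ?filter_uniq ?iota_uniq// => d.
rewrite -dvdn_divisors// mem_filter mem_index_iota ltnS.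
case dn : (d %| n)%N => //=; by rewrite (dvdn_gt0 n0 dn) dvdn_leq.
Qed.

Lemma sigma_le m n : (0 < n)%N -> (sigma m n <= n.+1 ^ m.+1)%N.
Proof.
move=> n0; rewrite sigmaE//.
apply: (@leq_trans (\sum_(1 <= d < n.+1) n.+1 ^ m)%N); last first.
  by rewrite sum_nat_const_nat subn1/= expnS leq_mul.
rewrite big_mkcond/= big_nat [leqRHS]big_nat; apply: leq_sum => d /andP[_ dn].
by case: ifP => // _; case: m => // m; rewrite leq_exp2r// ltnW.
Qed.

Lemma poly_growth_eis_coef k : poly_growth (eis_coef k).
Proof.
exists k.-1.+1, (`|bernoulli k / k`!%:R| + 2) => n; rewrite /eis_coef.
have C0 : 0 <= `|bernoulli k / k`!%:R| + 2 by rewrite addr_ge0.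
case: ifP => _; first by rewrite normr0 mulr_ge0// exprn_ge0.
case: eqP => [->|/eqP n0].
  by rewrite normrN expr1n mulr1 lerDl.
rewrite ger0_norm; last by rewrite !mulr_ge0// invr_ge0.
rewrite [leRHS]mulrDl ler_wpDl ?mulr_ge0 ?exprn_ge0// -mulrA ler_wpM2l//.
rewrite ler_pdivrMr ?ltr0n ?fact_gt0//.
have h : ((sigma k.-1 n)%:R <= n.+1%:R ^+ k.-1.+1 :> rat).
  by rewrite -natrX ler_nat sigma_le// lt0n.
apply: (le_trans h); rewrite ler_peMr ?exprn_ge0//.
by rewrite ler1n fact_gt0.
Qed.

Lemma qexp_const (q : R[i]) (c : rat) : qexp q (fun n => (n == 0%N)%:R * c) (ratr c).
Proof.
apply: (@cvg_cabs R _ _ _ _ (fun=> 0)); last exact: cvg_cst.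
near=> N; rewrite /qpsum.
have N0 : (0 < N)%N by near: N; exact: nbhs_infty_gt.
rewrite big_ltn// big_nat big1 => [|[|n]//= _]; last first.
  by rewrite mul0r rmorph0 mul0r.
by rewrite eqxx mul1r expr0 mulr1 addr0 subrr cabs0.
Unshelve. all: end_near. Qed.

Lemma eisenstein_qexp k tau : (0 < k)%N -> 0 < complex.Im tau ->
  qexp (qpar tau) (eis_coef k) (eisenstein k tau).
Proof.
move=> k0 t0; rewrite /eisenstein.
case: ifP => ok.
  by apply: eq_qexp (qexp0 _) => n; rewrite /eis_coef ok.
pose b n : rat := if n == 0%N then 0 else (sigma k.-1 n)%:R.
have gb : poly_growth b.
  exists k, 1 => n; rewrite /b mul1r.
  case: eqP => [_|/eqP n0]; first by rewrite normr0 exprn_ge0.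
  by rewrite normr_nat -natrX ler_nat -[k in (_ ^ k)%N]prednK// sigma_le// lt0n.
have [s hs] := qexp_cvg gb (cabs_qpar_lt1 t0).
have -> : csum_pos (fun n => (sigma k.-1 n)%:R * qpar tau ^+ n) = s.
  apply: (@cvg_lim R[i]^o (@norm_hausdorff _ _)).
  have -> : (fun N => \sum_(1 <= n < N) (sigma k.-1 n)%:R * qpar tau ^+ n : R[i]) =
            qpsum (qpar tau) b.
    apply/funext => -[|N]; first by rewrite /qpsum !big_geq.
    rewrite /qpsum [RHS]big_ltn// /b eqxx rmorph0 mul0r add0r !big_nat.
    by apply: eq_bigr => -[|n]//= _; rewrite ratr_nat.
  exact: hs.
pose c : rat := - (bernoulli k / (2 * k)%:R).
have H := @qexpZ R _ _ _ (2 / (k.-1)`!%:R) (qexpD (@qexp_const (qpar tau) c) hs).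
have -> : 2 / (k.-1)`!%:R * (- (ratr (bernoulli k) / (2 * k)%:R) + s) =
   ratr (2 / (k.-1)`!%:R) * (ratr c + s).
  by rewrite /c rmorphN !fmorph_div/= !ratr_nat.
apply: eq_qexp H => n; rewrite /eis_coef ok /b /c.
case: eqP => _; last by rewrite mul0r add0r mulrAC.
rewrite mul1r addr0 -[in k`!](prednK k0) factS prednK// !natrM.
have : (k.-1)`!%:R != 0 :> rat by rewrite pnatr_eq0 -lt0n fact_gt0.
have : k%:R != 0 :> rat by rewrite pnatr_eq0 -lt0n.
by move: (k%:R : rat) ((k.-1)`!%:R : rat) => u w u0 w0; field; rewrite u0 w0.
Qed.

End QDerivative.

(** * Bernoulli numbers *)

Section BernoulliIdentity.
Implicit Types (u x y z : rat).

(** The coefficient of T^m in exp(uT); the identities below are exponential identities read degree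
    by degree. *)
Definition phi (m : nat) u : rat := u ^+ m / m`!%:R.

Lemma fact_neq0 n : n`!%:R != 0 :> rat.
Proof. by rewrite pnatr_eq0 -lt0n fact_gt0. Qed.

Lemma phi0 u : phi 0 u = 1.
Proof. by rewrite /phi expr0 divr1. Qed.

Lemma phi1 u : phi 1 u = u.
Proof. by rewrite /phi expr1 divr1. Qed.

Lemma phi_at0 m : phi m 0 = (m == 0%N)%:R.
Proof. by rewrite /phi expr0n; case: m => [|m]; rewrite ?divr1// mul0r. Qed.

Lemma bin_phi M i : (i <= M)%N ->
  (i`!%:R)^-1 * ((M - i)`!%:R)^-1 = 'C(M, i)%:R / M`!%:R :> rat.
Proof.
move=> iM; rewrite -(bin_fact iM) !natrM.
have := fact_neq0 i; have := fact_neq0 (M - i).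
have : 'C(M, i)%:R != 0 :> rat by rewrite pnatr_eq0 -lt0n bin_gt0.
move: ('C(M, i)%:R : rat) (i`!%:R : rat) ((M - i)`!%:R : rat) => c a b c0 b0 a0.
by field; rewrite c0 b0 a0.
Qed.

Lemma phiD m u x : phi m (u + x) = \sum_(0 <= p < m.+1) phi p x * phi (m - p) u.
Proof.
rewrite /phi exprDn mulr_suml big_mkord; apply: eq_bigr => i _.
have im : (i <= m)%N by rewrite -ltnS.
by rewrite -mulr_natl [RHS]mulrACA bin_phi//; ring.
Qed.

Lemma phi_parity m u : phi m (- u) = (-1) ^+ m * phi m u.
Proof. by rewrite /phi (exprNn u) mulrA. Qed.

Lemma sum_delta1 (F : nat -> rat) m :
  \sum_(0 <= i < m.+2) (i == 1%N)%:R * F i = F 1%N.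
Proof.
rewrite big_ltn// big_ltn// big_nat big1; last first.
  by move=> [|[|i]]// _; rewrite mul0r.
by rewrite mul0r mul1r add0r addr0.
Qed.

(** Coefficient of T^(m+1) in xT/(e^(xT) - 1) * (e^((u+x)T) - e^(uT)) = xT e^(uT). *)
Lemma bernoulli_diff m u x :
  \sum_(0 <= i < m.+2) bernoulli i / i`!%:R * x ^+ i *
     (phi (m.+1 - i) (u + x) - phi (m.+1 - i) u) = x * phi m u.
Proof.
under eq_bigr do rewrite mulrBr; rewrite sumrB; apply/eqP; rewrite subr_eq; apply/eqP.
pose f i p := bernoulli i / i`!%:R * x ^+ i * phi p x * phi (m.+1 - i - p) u.
transitivity (\sum_(0 <= i < m.+2) \sum_(0 <= p < m.+2 - i) f i p).
  rewrite !big_nat; apply: eq_bigr => i /= im.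
  rewrite phiD mulr_sumr -subSn//; apply: eq_bigr => p _.
  by rewrite /f mulrA.
rewrite -sum_triangle.
(* In total degree [M] in x, the recurrence makes the terms l < M cancel unless M = 1; the term l =
   M is the one moved to the right-hand side. *)
have key M : (M < m.+2)%N -> \sum_(0 <= l < M.+1) f l (M - l)%N =
    (M == 1%N)%:R * (x * phi m u) +
    bernoulli M / M`!%:R * x ^+ M * phi (m.+1 - M) u.
  move=> Mm; transitivity (phi M x * phi (m.+1 - M) u *
      \sum_(0 <= l < M.+1) 'C(M, l)%:R * bernoulli l).
    rewrite mulr_sumr !big_nat; apply: eq_bigr => l /= lM.
    rewrite /f -subnDA subnKC//.
    transitivity (bernoulli l * (x ^+ l * x ^+ (M - l)) *
       (l`!%:R^-1 * (M - l)`!%:R^-1) * phi (m.+1 - M) u).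
      by rewrite {1}/phi; ring.
    by rewrite bin_phi// -exprD subnKC// {2}/phi; ring.
  rewrite big_mkord big_ord_recr/= binn mul1r.
  case: M Mm => [|M] Mm; first by rewrite big_ord0 phi0 fact0 expr0 /=; field.
  rewrite bernoulli_rec eqSS.
  case: M Mm => [|M] Mm; last by rewrite (_ : (M.+1 == 0)%N = false)// mul0r !add0r {1}/phi; ring.
  by rewrite (_ : (0 == 0)%N%:R = 1)// subSS subn0 phi1; field.
rewrite big_nat; under eq_bigr => M Mm do rewrite key//; rewrite -big_nat big_split/=.
by rewrite (sum_delta1 (fun=> x * phi m u)).
Qed.

(** Vanishing of B_i for odd i > 1. Taking [bernoulli_diff] from 0 to 1 and then backwards with x =
    -1, and adding, gives linear relations for the differences [c i]; the system is triangular with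
    unit diagonal. *)
Lemma bernoulli_odd_coef i :
  bernoulli i / i`!%:R * ((-1) ^+ i - 1) = (i == 1%N)%:R.
Proof.
apply/eqP; rewrite -subr_eq0; apply/eqP.
pose c i := bernoulli i / i`!%:R * ((-1) ^+ i - 1) - (i == 1%N)%:R.
rewrite -/(c i).
have h m : \sum_(0 <= i < m.+2) c i * (phi (m.+1 - i) 1 - phi (m.+1 - i) 0) = 0.
  have h1 := bernoulli_diff m 0 1; have h2 := bernoulli_diff m 1 (-1).
  rewrite add0r in h1; rewrite subrr in h2.
  under eq_bigr do rewrite mulrBl; rewrite sumrB.
  rewrite [X in _ - X](_ : _ = phi m 1 - phi m 0); last first.
    rewrite (sum_delta1 (fun i => phi (m.+1 - i) 1 - phi (m.+1 - i) 0)).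
    by rewrite subSS subn0.
  rewrite [X in X - _](_ : _ = - (-1 * phi m 1) - 1 * phi m 0); first by ring.
  rewrite -h1 -h2 -sumrN -sumrB; apply: eq_bigr => j _.
  by rewrite expr1n; ring.
elim/ltn_ind: i => i IH; have := h i; rewrite big_nat_recr//= subnn !phi0 subrr mulr0 addr0.
rewrite big_nat_recr//= subSnn big_nat big1 => [|j /= ji]; last by rewrite IH// mul0r.
by rewrite add0r !phi1 subr0 mulr1.
Qed.

(** The coefficients of the even function (T/2) coth(T/2) = T/(e^T - 1) + T/2. *)
Definition beta i : rat := if odd i then 0 else bernoulli i / i`!%:R.

Lemma betaE i : beta i = bernoulli i / i`!%:R + (i == 1%N)%:R / 2.
Proof.
rewrite /beta; have := bernoulli_odd_coef i; rewrite -signr_odd.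
case: ifP => oi; last by case: eqP oi => [->//|_ _ _]; rewrite mul0r addr0.
rewrite expr1 => h; have -> : bernoulli i / i`!%:R = - (i == 1%N)%:R / 2 by lra.
by rewrite mulNr addNr.
Qed.

(** Adding T/2 to the Bernoulli series replaces the value at the left end by the mean of both ends,
    as in the trapezoidal rule. *)
Lemma beta_diff m u x :
  \sum_(0 <= i < m.+2) beta i * x ^+ i *
     (phi (m.+1 - i) (u + x) - phi (m.+1 - i) u) = x / 2 * (phi m (u + x) + phi m u).
Proof.
under eq_bigr do rewrite betaE mulrDl mulrDl.
rewrite big_split/= bernoulli_diff.
rewrite [X in _ + X](_ : _ = x / 2 * (phi m (u + x) - phi m u)); first by field.
transitivity (2^-1 * x ^+ 1 * (phi (m.+1 - 1) (u + x) - phi (m.+1 - 1) u)); last first.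
  by rewrite subSS subn0; ring.
rewrite -(sum_delta1 (fun i => 2^-1 * x ^+ i * (phi (m.+1 - i) (u + x) - phi (m.+1 - i) u)) m).
by apply: eq_bigr => i _; ring.
Qed.

End BernoulliIdentity.

(** * Convolutions of divisor sums *)

Section DivisorSums.
Variable n : nat.
Implicit Types (g : nat -> rat) (phi : rat -> rat) (x y z : rat).

(** Cutting every variable off at [n] loses nothing, because ab + cd = n with positive entries
    forces this bound. *)
Let S g : rat := \sum_(1 <= a < n.+1) g a.

Lemma sum_shift c g : (forall a, (n < a)%N -> g a = 0) ->
  S (fun a => (c < a)%N%:R * g a) = S (fun a => g (a + c)%N).
Proof.
move=> g0; rewrite /S.
rewrite [LHS](_ : _ = \sum_(1 <= a < n.+1 + c) (c < a)%N%:R * g a); last first.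
  rewrite [RHS](@big_cat_nat _ _ _ n.+1)//= ?leq_addr//.
  rewrite [X in _ + X]big_nat [X in _ + X]big1 ?addr0// => a /andP[na _].
  by rewrite g0 ?mulr0.
rewrite (@big_cat_nat _ _ _ c.+1)//=; last by rewrite addSn ltnS leq_addl.
rewrite [X in X + _]big_nat [X in X + _]big1 ?add0r; last first.
  by move=> a /andP[_ ac]; rewrite ltnNge -ltnS ac mul0r.
rewrite -[c.+1]add1n big_addn addnK !big_nat; apply: eq_bigr => a /andP[a0 _].
by rewrite -[X in (X < _)%N]add0n ltn_add2r a0 mul1r.
Qed.

Let I a b c d : rat := (a * b + c * d == n)%N%:R.

Let Q (F : nat -> nat -> nat -> nat -> rat) : rat :=
  S (fun a => S (fun b => S (fun c => S (fun d => I a b c d * F a b c d)))).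

Let eq_S g g' : (forall a, (0 < a)%N -> g a = g' a) -> S g = S g'.
Proof. by move=> h; rewrite /S !big_nat; apply: eq_bigr => a /andP[a0 _]; rewrite h. Qed.

Let exchS (f : nat -> nat -> rat) :
  S (fun a => S (fun b => f a b)) = S (fun b => S (fun a => f a b)).
Proof. exact: exchange_big_nat. Qed.

Let SD f g : S (fun a => f a + g a) = S f + S g.
Proof. exact: big_split. Qed.

Let eq_Q F F' : (forall a b c d, (0 < a)%N -> (0 < b)%N -> (0 < c)%N -> (0 < d)%N ->
   F a b c d = F' a b c d) -> Q F = Q F'.
Proof. by move=> h; do 4!(apply: eq_S => ? ?); rewrite h. Qed.

Let QD F G : Q (fun a b c d => F a b c d + G a b c d) = Q F + Q G.
Proof.
rewrite /Q -SD; apply: eq_S => a _; rewrite -SD; apply: eq_S => b _.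
rewrite -SD; apply: eq_S => c _; rewrite -SD; apply: eq_S => d _.
by rewrite mulrDr.
Qed.

Let Q_swap F : Q F = Q (fun a b c d => F c d a b).
Proof.
rewrite /Q; etransitivity; first by apply: eq_S => a _; exact: exchS.
rewrite exchS; apply: eq_S => c _.
etransitivity; first by apply: eq_S => a _; exact: exchS.
rewrite exchS; apply: eq_S => d _; apply: eq_S => a _; apply: eq_S => b _.
by rewrite /I addnC.
Qed.

Let Q_reorder F :
  Q F = S (fun b => S (fun c => S (fun a => S (fun d => I a b c d * F a b c d)))).
Proof. by rewrite /Q exchS; apply: eq_S => b _; exact: exchS. Qed.

Let S_delta a g : (0 < a <= n)%N -> S (fun c => (c == a)%N%:R * g c) = g a.
Proof.
move=> an; rewrite /S (bigD1_seq a) ?iota_uniq ?mem_index_iota//=.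
by rewrite eqxx mul1r big1 ?addr0// => c /negbTE->; rewrite mul0r.
Qed.

Let S_delta0 a g : (n < a)%N -> S (fun c => (c == a)%N%:R * g c) = 0.
Proof.
move=> an; rewrite /S big_nat big1// => c /andP[_ ca].
by rewrite (_ : (c == a) = false) ?mul0r//; apply/negbTE; lia.
Qed.

Let SZ c g : S (fun a => c * g a) = c * S g.
Proof. by rewrite /S mulr_sumr. Qed.

Let dvdn_sum (f : nat -> rat) l : (0 < l <= n)%N ->
  \sum_(1 <= a < l.+1 | (a %| l)%N) f a = S (fun a => S (fun b => (a * b == l)%N%:R * f a)).
Proof.
move=> /andP[l0 ln]; rewrite [RHS](@big_cat_nat _ _ _ l.+1)//=.
rewrite [X in _ = _ + X]big_nat [X in _ = _ + X]big1 ?addr0; last first.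
  move=> a /andP[la _]; rewrite /S big_nat big1// => b /andP[b0 _].
  by rewrite (_ : (_ == _) = false) ?mul0r//; apply/negbTE; nia.
rewrite big_mkcond/= !big_nat; apply: eq_bigr => a /andP[a0 al].
case: ifP => [/dvdnP[m lE]|al'].
  have m0 : (0 < m <= n)%N by nia.
  rewrite -[LHS](S_delta (fun=> f a) m0); apply: eq_S => b b0.
  by rewrite lE [(m * a)%N]mulnC eqn_pmul2l.
rewrite /S big_nat big1// => b _; case: eqP => [lE|_]; last by rewrite mul0r.
by move: al'; rewrite -lE dvdn_mulr.
Qed.

Let I0 a b c d : (0 < b)%N -> (n < a)%N -> I a b c d = 0.
Proof. by move=> b0 an; rewrite /I (_ : (_ == _) = false)//; apply/negbTE; nia. Qed.

Variables (phi : rat -> rat) (phiN : forall u, phi (- u) = phi u).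

Let Fless x y := Q (fun a b c d => (b < d)%N%:R * phi (a%:R * x - c%:R * y)).

(* In the region [c < a] one has [a x + c y = (a - c) x - c z], and the
   substitution [(a, b, c, d) -> (a - c, b, c, b + d)] preserves [a b + c d]. *)
Let Q_less x y z : x + y + z = 0 ->
  Q (fun a b c d => (c < a)%N%:R * phi (a%:R * x + c%:R * y)) = Fless x z.
Proof.
move=> xyz; rewrite /Fless !Q_reorder; apply: eq_S => b b0; apply: eq_S => c c0.
transitivity (S (fun a => (c < a)%N%:R *
    S (fun d => I a b c d * phi (a%:R * x + c%:R * y)))).
  by apply: eq_S => a _; rewrite -SZ; apply: eq_S => d _; rewrite mulrCA.
rewrite sum_shift; last first.
  by move=> a an; rewrite /S big1// => d _; rewrite I0// mul0r.
apply: eq_S => a a0.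
transitivity (S (fun d => (b < d)%N%:R * (I a b c d * phi (a%:R * x - c%:R * z)))).
  rewrite sum_shift => [|d dn]; last first.
    by rewrite /I (_ : (_ == _) = false) ?mul0r//; apply/negbTE; nia.
  apply: eq_S => d d0; congr (_ * phi _).
    by rewrite /I; congr ((_ == _)%:R); nia.
  rewrite natrD; have -> : z = - (x + y) by lra.
  by ring.
by apply: eq_S => d d0; rewrite mulrCA.
Qed.

Let Q_sum_split x y z : x + y + z = 0 ->
  Q (fun a b c d => phi (a%:R * x + c%:R * y)) =
  Fless x z + Fless y z +
  Q (fun a b c d => (a == c)%N%:R * phi (a%:R * x + c%:R * y)).
Proof.
move=> xyz; rewrite -(Q_less xyz) -(@Q_less y x z) 1?[y + x]addrC//.
rewrite [X in _ = _ + X + _]Q_swap -!QD; apply: eq_Q => a b c d _ _ _ _.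
rewrite [c%:R * y + _]addrC; case: (ltngtP a c) => _; rewrite !(mul0r, mul1r, addr0, add0r)//.
Qed.

(** Exchanging (a, b) with (c, d) maps the region d < b to b < d and reverses the sign of the
    argument, which the evenness of [phi] absorbs. *)
Let Q_diff_split x y :
  Q (fun a b c d => phi (a%:R * x - c%:R * y)) =
  Fless x y + Fless y x +
  Q (fun a b c d => (b == d)%N%:R * phi (a%:R * x - c%:R * y)).
Proof.
rewrite /Fless [X in _ = _ + X + _]Q_swap -!QD; apply: eq_Q => a b c d _ _ _ _.
rewrite -(phiN (c%:R * y - _)) opprB.
case: (ltngtP b d) => _; rewrite !(mul0r, mul1r, addr0, add0r)//.
Qed.

Hypothesis n0 : (0 < n)%N.

Let count_sum m : (0 < m <= n)%N ->
  S (fun b => S (fun d => (b + d == m)%N%:R)) = m%:R - 1.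
Proof.
move=> /andP[m0 mn]; transitivity (S (fun b => (b < m)%N%:R)).
  apply: eq_S => b b0; case: (ltnP b m) => bm; last first.
    rewrite /S big_nat big1// => d /andP[d0 _].
    by rewrite (_ : (_ == _) = false)//; apply/negbTE; lia.
  have mb : (0 < m - b <= n)%N by lia.
  rewrite -[RHS](S_delta (fun=> 1) mb); apply: eq_S => d _.
  by rewrite mulr1; congr (_%:R); congr nat_of_bool; apply/eqP/eqP; lia.
rewrite /S (@big_cat_nat _ _ _ m)//=; last by lia.
rewrite [X in _ + X]big_nat [X in _ + X]big1 ?addr0; last first.
  by move=> b /andP[mb _]; rewrite ltnNge mb.
transitivity (\sum_(1 <= b < m) (1 : rat)).
  by rewrite !big_nat; apply: eq_bigr => b /andP[_ ->].
by rewrite sumr_const_nat natrB.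
Qed.

(** On a = c the argument is -a z and the condition reads a (b + d) = n, which leaves n/a - 1
    choices of (b, d). *)
Let Q_diag x y z : x + y + z = 0 ->
  Q (fun a b c d => (a == c)%N%:R * phi (a%:R * x + c%:R * y)) =
  \sum_(1 <= a < n.+1 | (a %| n)%N) ((n %/ a)%:R - 1) * phi (a%:R * z).
Proof.
move=> xyz; rewrite big_mkcond; rewrite /Q /S !big_nat; apply: eq_bigr => a an.
rewrite -/(S _) (_ : S _ = S (fun b => S (fun d => (a * (b + d) == n)%N%:R * phi (a%:R * z)))); last first.
  apply: eq_S => b _.
  rewrite -(@S_delta a (fun c => S (fun d => (a * (b + d) == n)%N%:R * phi (a%:R * z)))) //.
  apply: eq_S => c _; rewrite -SZ; apply: eq_S => d _.
  rewrite /I mulnDr; case: (eqVneq c a) => [->|]; rewrite ?eqxx ?mul1r ?mul0r ?mulr0//.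
  rewrite -mulrDr -phiN -mulrN; have -> : - (x + y) = z by lra.
  by [].
case: ifP => [/dvdnP[m nE]|an'].
  have m0 : (0 < m <= n)%N by nia.
  rewrite {2}nE mulnK; last by case/andP: an.
  rewrite -(count_sum m0) [RHS]mulrC -SZ; apply: eq_S => b _; rewrite -SZ; apply: eq_S => d _.
  by rewrite mulrC nE [(m * a)%N]mulnC eqn_pmul2l//; case/andP: an.
rewrite /S big1// => b _; rewrite big1// => d _; case: eqP => [nE|_]; last by rewrite mul0r.
by move: an'; rewrite -nE dvdn_mulr.
Qed.

(** It runs over the splittings of a divisor d into two positive parts. The same sum reappears in
    [cross_hook] as the interior of an arithmetic progression. *)
Definition hook_sum (phi : rat -> rat) d x y : rat :=
  \sum_(1 <= j < d) phi ((d - j)%:R * x - j%:R * y).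

(** On b = d the condition reads (a + c) b = n, so a + c is a divisor D of n and c runs from 1 to D
    - 1. *)
Let Q_codiag x y :
  Q (fun a b c d => (b == d)%N%:R * phi (a%:R * x - c%:R * y)) =
  \sum_(1 <= d < n.+1 | (d %| n)%N) hook_sum phi d x y.
Proof.
rewrite dvdn_sum; last by rewrite n0 leqnn.
rewrite Q_reorder [RHS]exchS; apply: eq_S => b b0.
transitivity (S (fun D => S (fun c => (c < D)%N%:R *
    ((D * b == n)%N%:R * phi ((D - c)%:R * x - c%:R * y))))); last first.
  rewrite /S !big_nat; apply: eq_bigr => D /andP[D0 Dn].
  rewrite /hook_sum mulr_sumr (@big_cat_nat _ _ _ D)//=; last by lia.
  rewrite [X in _ + X]big_nat [X in _ + X]big1 ?addr0; last first.
    by move=> c /andP[Dc _]; rewrite ltnNge Dc mul0r.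
  by rewrite !big_nat; apply: eq_bigr => c /andP[_ ->]; rewrite mul1r.
rewrite [RHS]exchS; apply: eq_S => c c0; rewrite sum_shift; last first.
  by move=> D Dn; rewrite (_ : (_ == _) = false) ?mul0r//; apply/negbTE; nia.
rewrite /S !big_nat; apply: eq_bigr => a /andP[a0 an].
transitivity (S (fun d => (d == b)%N%:R * (((a + c) * b == n)%N%:R * phi (a%:R * x - c%:R * y)))).
  apply: eq_S => d d0; case: (eqVneq d b) => [->|db]; last first.
    by rewrite !mul0r mulr0.
  by rewrite !mul1r /I mulnDl.
case: (leqP b n) => bn; first by rewrite S_delta ?b0// addnK.
rewrite S_delta0// (_ : (_ == _) = false) ?mul0r//; apply/negbTE; nia.
Qed.

Let dconv (F : nat -> nat -> rat) : rat :=
  \sum_(1 <= l < n) \sum_(1 <= a < l.+1 | (a %| l)%N)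
    \sum_(1 <= c < (n - l).+1 | (c %| n - l)%N) F a c.

Let dconvE F : dconv F = Q (fun a b c d => F a c).
Proof.
rewrite /dconv; transitivity (\sum_(1 <= l < n) S (fun a => S (fun b => S (fun c => S (fun d =>
   (a * b == l)%N%:R * ((c * d == n - l)%N%:R * F a c)))))).
  rewrite !big_nat; apply: eq_bigr => l /andP[l0 ln].
  rewrite dvdn_sum ?l0 1?ltnW//; apply: eq_S => a _; apply: eq_S => b _.
  rewrite dvdn_sum ?subn_gt0 ?ln ?leq_subr// -SZ; apply: eq_S => c _.
  by rewrite -SZ.
rewrite exchange_big_nat; apply: eq_S => a a0.
rewrite exchange_big_nat; apply: eq_S => b b0.
rewrite exchange_big_nat; apply: eq_S => c c0.
rewrite exchange_big_nat; apply: eq_S => d d0.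
case: (ltnP (a * b) n) => abn; last first.
  rewrite /I (_ : (_ == _) = false) ?mul0r; last by apply/negbTE; nia.
  rewrite big_nat big1// => l /andP[_ ln].
  by rewrite (_ : (_ == _) = false) ?mul0r//; apply/negbTE; lia.
rewrite (bigD1_seq (a * b)%N) ?iota_uniq ?mem_index_iota//=; last by nia.
rewrite eqxx mul1r big1 ?addr0; last first.
  by move=> l /negbTE; rewrite eq_sym => ->; rewrite mul0r.
by rewrite /I; congr (_%:R * _); congr nat_of_bool; apply/eqP/eqP; lia.
Qed.

(** The plus terms and the minus terms each produce [Fless] once for all six ordered pairs among x,
    y, z. These cancel, and only the diagonals a = c and b = d remain. *)
Lemma divisor_convolution x y z : x + y + z = 0 ->
  dconv (fun a c => phi (a%:R * x + c%:R * y) - phi (a%:R * x - c%:R * y)) +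
  dconv (fun a c => phi (a%:R * y + c%:R * z) - phi (a%:R * y - c%:R * z)) +
  dconv (fun a c => phi (a%:R * z + c%:R * x) - phi (a%:R * z - c%:R * x)) =
  \sum_(1 <= d < n.+1 | (d %| n)%N)
    (((n %/ d)%:R - 1) * (phi (d%:R * x) + phi (d%:R * y) + phi (d%:R * z)) -
     (hook_sum phi d x y + hook_sum phi d y z + hook_sum phi d z x)).
Proof.
move=> xyz.
have yzx : y + z + x = 0 by lra.
have zxy : z + x + y = 0 by lra.
have QB F G : Q (fun a b c d => F a c - G a c) = Q (fun a b c d => F a c) - Q (fun a b c d => G a c).
  by apply/eqP; rewrite eq_sym subr_eq -QD; apply/eqP; apply: eq_Q => *; rewrite subrK.
rewrite !dconvE !QB !Q_diff_split (Q_sum_split xyz) (Q_sum_split yzx) (Q_sum_split zxy).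
rewrite (Q_diag xyz) (Q_diag yzx) (Q_diag zxy) !Q_codiag sumrB.
under [X in _ = X - _]eq_bigr do rewrite !mulrDr.
by rewrite !big_split/=; ring.
Qed.

End DivisorSums.

(** * The hyperbolic cotangent *)

Section CotangentIdentity.
Implicit Types (x y z : rat) (p q : {poly rat}).

(** Divisibility by X^N stands for the congruence of power series modulo X^N. *)
Lemma dvdXnP N p : reflect (forall i, (i < N)%N -> p`_i = 0) ('X^N %| p).
Proof.
apply: (iffP idP) => [/dvdpP[q ->] i iN|h]; first by rewrite coefMXn iN.
rewrite -(poly_take_drop N p) (_ : take_poly N p = 0) ?add0r ?dvdp_mulIr//.
by apply/polyP => i; rewrite coef_take_poly coef0; case: ifP => // /h.
Qed.

Variable N : nat.
Hypothesis N1 : (1 < N)%N.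

Let g x : {poly rat} := \poly_(i < N) (beta i * x ^+ i).
Let E x : {poly rat} := \poly_(i < N) phi i x.

Let coefE x i : (i < N)%N -> (E x)`_i = phi i x.
Proof. by move=> iN; rewrite coef_poly iN. Qed.

Let coefg x i : (i < N)%N -> (g x)`_i = beta i * x ^+ i.
Proof. by move=> iN; rewrite coef_poly iN. Qed.

(** The relation coth(w/2) = (e^w + 1)/(e^w - 1) at w = xX, cleared of its denominator; it is
    [beta_diff] at u = 0. *)
Let gE x : 'X^N %| g x * (E x - 1) - (x / 2)%:P * 'X * (E x + 1).
Proof.
apply/dvdXnP => -[|m] mN.
  rewrite coefB -mulrA coefCM coefXM mulr0 subr0 coefM big_ord1 subnn coefB coef1.
  by rewrite coefE// phi0 subrr mulr0.
rewrite coefB -mulrA coefCM coefXM /= coefD coef1 (coefE _ (ltnW mN)).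
have := beta_diff m 0 x; rewrite add0r phi_at0 => <-.
apply/eqP; rewrite subr_eq0; apply/eqP; rewrite coefM big_mkord.
apply: eq_bigr => i _; rewrite coefB coef1 phi_at0.
have iN : (i < N)%N by have := ltn_ord i; lia.
have miN : (m.+1 - i < N)%N by lia.
by rewrite coefg// coefE.
Qed.

Let ED x y : 'X^N %| E x * E y - E (x + y).
Proof.
apply/dvdXnP => m mN; rewrite coefB coefM coefE// [x + y]addrC phiD big_mkord.
apply/eqP; rewrite subr_eq0; apply/eqP; apply: eq_bigr => i _.
have iN : (i < N)%N by have := ltn_ord i; lia.
have miN : (m - i < N)%N by lia.
by rewrite !coefE.
Qed.

Let E0 : E 0 = 1.
Proof.
apply/polyP => i; rewrite coef_poly phi_at0 coef1.
by case: ifP => // /negbT; case: i => [|i]//; rewrite -leqNgt leqn0; lia.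
Qed.

Let EM x y z : x + y + z = 0 -> 'X^N %| E x * E y * E z - 1.
Proof.
move=> xyz; have h1 := ED x y; have h2 := ED (x + y) z.
rewrite xyz E0 in h2.
have -> : E x * E y * E z - 1 = (E x * E y - E (x + y)) * E z + (E (x + y) * E z - 1) by ring.
by rewrite dvdp_add// dvdp_mulr.
Qed.

Let ME x : x != 0 -> exists2 v : {poly rat}, E x - 1 = v * 'X & forall n, coprimep 'X^n v.
Proof.
move=> x0; exists (drop_poly 1 (E x - 1)).
  rewrite -[LHS](poly_take_drop 1) expr1 (_ : take_poly 1 _ = 0) ?add0r//.
  apply/polyP => i; rewrite coef_take_poly coef0; case: i => //.
  by rewrite /= coefB coef1 coefE ?phi0 ?subrr// ltnW.
move=> n; apply: coprimep_expl; rewrite coprimep_sym coprimepX.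
by rewrite rootE horner_coef0 coef_drop_poly coefB coef1 coefE// phi1 subr0.
Qed.

Let dvd_mul_sub p p' q q' : 'X^N %| p - p' -> 'X^N %| q - q' -> 'X^N %| p * q - p' * q'.
Proof.
move=> h1 h2; have -> : p * q - p' * q' = p * (q - q') + (p - p') * q' by ring.
by apply: dvdp_add; [exact: dvdp_mull | exact: dvdp_mulr].
Qed.

(** With C(w) = coth(wX/2) this is C(x)C(y) + C(y)C(z) + C(z)C(x) = -1 multiplied by xyz X^2 / 4.
    Each denominator [E w - 1] is X times a factor prime to X, so cancelling three of them costs
    X^3. *)
Lemma beta_poly_identity x y z : x + y + z = 0 -> x != 0 -> y != 0 -> z != 0 ->
  'X^(N - 3) %| z%:P * (g x * g y) + x%:P * (g y * g z) + y%:P * (g z * g x)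
     + (x * y * z / 4)%:P * 'X^2.
Proof.
move=> xyz x0 y0 z0; set A := (X in _ %| X).
have [N3|N3] := leqP N 3; first by rewrite (_ : N - 3 = 0)%N ?expr0 ?dvd1p//; lia.
have [vx vxE vxc] := ME x0; have [vy vyE vyc] := ME y0; have [vz vzE vzc] := ME z0.
suff : 'X^N %| A * ((E x - 1) * (E y - 1) * (E z - 1)).
  rewrite vxE vyE vzE.
  have -> : A * (vx * 'X * (vy * 'X) * (vz * 'X)) = A * vx * vy * vz * 'X^3 by ring.
  rewrite -[in 'X^N](subnK (ltnW N3)) exprD dvdp_mul2r; last first.
    by rewrite expf_neq0// polyX_eq0.
  by rewrite !Gauss_dvdpl.
have hx := gE x; have hy := gE y; have hz := gE z; have hE := EM xyz.
set ax := _%:P * _ * _ in hx; set ay := _%:P * _ * _ in hy; set az := _%:P * _ * _ in hz.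
(* Once each g w (E w - 1) is replaced by (wX/2)(E w + 1), what is left is a multiple of E x E y E z
   - 1, since the cyclic sum of (c-1)(a+1)(b+1) plus (a-1)(b-1)(c-1) is 4(abc - 1). *)
have -> : A * ((E x - 1) * (E y - 1) * (E z - 1)) =
  z%:P * (E z - 1) * (g x * (E x - 1) * (g y * (E y - 1)) - ax * ay) +
  x%:P * (E x - 1) * (g y * (E y - 1) * (g z * (E z - 1)) - ay * az) +
  y%:P * (E y - 1) * (g z * (E z - 1) * (g x * (E x - 1)) - az * ax) +
  (x * y * z)%:P * 'X^2 * (E x * E y * E z - 1).
  have h2 w : (w / 2)%:P = w%:P * (2^-1)%:P :> {poly rat} by rewrite polyCM.
  have h4 : (x * y * z / 4)%:P = x%:P * y%:P * z%:P * (2^-1)%:P * (2^-1)%:P :> {poly rat}.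
    by rewrite -!polyCM; congr _%:P; field.
  have h5 : (x * y * z)%:P = 4 * x%:P * y%:P * z%:P * (2^-1)%:P * (2^-1)%:P :> {poly rat}.
    have -> : 4 = 4%:P :> {poly rat} by rewrite polyC_natr.
    by rewrite -!polyCM; congr _%:P; field.
  rewrite /ax /ay /az !h2 h5 /A h4; ring.
(apply: dvdp_add; first (apply: dvdp_add; first apply: dvdp_add));
  by apply: dvdp_mull => //; exact: dvd_mul_sub.
Qed.

End CotangentIdentity.

(** Degree n of [beta_poly_identity], with truncation at n + 4 to allow for the three lost degrees;
    n > 2 avoids the term in X^2. *)
Lemma sum_beta_cyclic (x y z : rat) n : x + y + z = 0 -> x != 0 -> y != 0 -> z != 0 ->
  (2 < n)%N ->
  z * (\sum_(i < n.+1) beta i * x ^+ i * (beta (n - i) * y ^+ (n - i))) +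
  x * (\sum_(i < n.+1) beta i * y ^+ i * (beta (n - i) * z ^+ (n - i))) +
  y * (\sum_(i < n.+1) beta i * z ^+ i * (beta (n - i) * x ^+ (n - i))) = 0.
Proof.
move=> xyz x0 y0 z0 n2.
have n4 : (1 < n + 4)%N by lia.
have nn : (n < n + 4 - 3)%N by lia.
have /dvdXnP/(_ n nn) := beta_poly_identity n4 xyz x0 y0 z0.
have c u v : (\poly_(i < n + 4) (beta i * u ^+ i) * \poly_(i < n + 4) (beta i * v ^+ i))`_n
  = \sum_(i < n.+1) beta i * u ^+ i * (beta (n - i) * v ^+ (n - i)).
  rewrite coefM; apply: eq_bigr => i _.
  have iN : (i < n + 4)%N by have := ltn_ord i; lia.
  have niN : (n - i < n + 4)%N by lia.
  by rewrite coef_poly iN coef_poly niN.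
have n2' : (n == 2)%N = false by lia.
rewrite coefD coefCM coefXn n2' mulr0 addr0 coefD coefCM coefD coefCM coefCM.
by rewrite c c c.
Qed.

(** * Cyclic identity for the coefficients *)

Definition eisP_coef (i j n : nat) : rat :=
  conv (eis_coef i) (eis_coef j) n + (i == 2%N)%:R * (n%:R * eis_coef j n / j%:R)
  + (j == 2%N)%:R * (n%:R * eis_coef i n / i%:R).

Definition eisW_coef (i j n : nat) : rat :=
  eisP_coef i j n - (-1) ^+ j * eis_coef (i + j) n.

Section CyclicIdentity.
Variable K : nat.
Hypotheses (K0 : (0 < K)%N) (Keven : ~~ odd K).
Implicit Types x y z : rat.

Let oddKm m : (m <= K)%N -> odd (K - m) = odd m.
Proof. by move=> mK; rewrite oddB// (negbTE Keven). Qed.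

(** A geometric sum with denominator x + y = -z; K even gives the plus sign between the two
    powers. *)
Let signE x y z : x + y + z = 0 -> z != 0 ->
  \sum_(m < K.+1) (-1) ^+ (K - m) * (x ^+ m * y ^+ (K - m)) =
  - (x ^+ K.+1 + y ^+ K.+1) / z.
Proof.
move=> xyz z0; have -> : z = - (x + y) by lra.
have xy0 : x + y != 0 by apply: contra z0 => /eqP xy; rewrite -xyz xy add0r.
rewrite invrN mulrNN; apply: (mulIf xy0); rewrite divfK//.
have sg : (-1) ^+ K = 1 :> rat by rewrite -signr_odd (negbTE Keven).
have hy : (- y) ^+ K.+1 = - y ^+ K.+1 by rewrite !exprS (exprNn y) sg; ring.
have := subrXX (- y) x K.+1; rewrite hy => h.
have -> : x ^+ K.+1 + y ^+ K.+1 = - (- y ^+ K.+1 - x ^+ K.+1) by ring.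
rewrite h mulrC -mulNr; congr (_ * _); first by ring.
by apply: eq_bigr => m _; rewrite (exprNn y) /=; ring.
Qed.

Let derivE n x y :
  \sum_(m < K.+1) ((m.+1 == 2%N)%:R * (n%:R * eis_coef (K - m).+1 n / (K - m).+1%:R)
     + ((K - m).+1 == 2%N)%:R * (n%:R * eis_coef m.+1 n / m.+1%:R)) *
     (x ^+ m * y ^+ (K - m)) =
  n%:R * eis_coef K n / K%:R * (x * y ^+ K.-1 + x ^+ K.-1 * y).
Proof.
under eq_bigr do rewrite mulrDl; rewrite big_split/= mulrDr; congr (_ + _).
  have K1 : (1 < K.+1)%N by [].
  rewrite (bigD1 (Ordinal K1))//= big1 ?addr0; last first.
    move=> m m1; rewrite (_ : (_ == _) = false) ?mul0r//.
    by apply: contraNF m1 => /eqP [m1]; apply/eqP/val_inj.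
  by rewrite mul1r -subSn// subSS subn0 subn1 expr1.
have K1 : (K.-1 < K.+1)%N by lia.
rewrite (bigD1 (Ordinal K1))//= big1 ?addr0; last first.
  move=> m m1; rewrite (_ : (_ == _) = false) ?mul0r//.
  apply: contraNF m1 => /eqP h; apply/eqP/val_inj => /=; have := ltn_ord m; lia.
have -> : (K - K.-1 = 1)%N by lia.
by rewrite mul1r prednK// expr1.
Qed.

Let splitT n x y z : x + y + z = 0 -> z != 0 ->
  \sum_(m < K.+1) eisW_coef m.+1 (K - m).+1 n * (x ^+ m * y ^+ (K - m)) =
  \sum_(m < K.+1) conv (eis_coef m.+1) (eis_coef (K - m).+1) n * (x ^+ m * y ^+ (K - m))
  + n%:R * eis_coef K n / K%:R * (x * y ^+ K.-1 + x ^+ K.-1 * y)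
  - eis_coef K.+2 n * (x ^+ K.+1 + y ^+ K.+1) / z.
Proof.
move=> xyz z0; rewrite -derivE -[- (_ / z)]mulNr -mulrN -mulrA -(signE xyz z0) mulr_sumr -!big_split/=.
apply: eq_bigr => m _; rewrite /eisW_coef /eisP_coef.
have -> : (m.+1 + (K - m).+1 = K.+2)%N by have := ltn_ord m; lia.
by rewrite exprS; ring.
Qed.

Lemma eis_coef_at0 i : eis_coef i 0 = - beta i.
Proof. by rewrite /eis_coef /beta; case: ifP; rewrite ?oppr0. Qed.

Lemma beta0 : beta 0 = 1.
Proof. by rewrite /beta /= /bernoulli /= big_ord0 mulr0 subr0 divr1. Qed.

(** Multiplied by xyz this is [sum_beta_cyclic] in degree K + 2. The inner terms give the products
    of constant terms, and the two end terms, where beta 0 = 1 occurs, give the constant term of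
    E_(K+2). *)
Lemma eisW_cyclic0 x y z : x + y + z = 0 -> x != 0 -> y != 0 -> z != 0 ->
  \sum_(m < K.+1) eisW_coef m.+1 (K - m).+1 0 * (x ^+ m * y ^+ (K - m)) +
  \sum_(m < K.+1) eisW_coef m.+1 (K - m).+1 0 * (y ^+ m * z ^+ (K - m)) +
  \sum_(m < K.+1) eisW_coef m.+1 (K - m).+1 0 * (z ^+ m * x ^+ (K - m)) = 0.
Proof.
move=> xyz x0 y0 z0.
have yzx : y + z + x = 0 by lra.
have zxy : z + x + y = 0 by lra.
rewrite (splitT 0 xyz z0) (splitT 0 yzx x0) (splitT 0 zxy y0) !mul0r !addr0.
pose s u v := \sum_(m < K.+1) beta m.+1 * beta (K - m).+1 * (u ^+ m * v ^+ (K - m)).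
have cs u v : \sum_(m < K.+1) conv (eis_coef m.+1) (eis_coef (K - m).+1) 0 *
    (u ^+ m * v ^+ (K - m)) = s u v.
  apply: eq_bigr => m _; rewrite /conv big_nat1 !eis_coef_at0; ring.
rewrite !cs.
have K2 : (2 < K.+2)%N by lia.
have := sum_beta_cyclic xyz x0 y0 z0 K2.
have S u v : \sum_(i < K.+3) beta i * u ^+ i * (beta (K.+2 - i) * v ^+ (K.+2 - i)) =
    u * v * s u v + beta K.+2 * (u ^+ K.+2 + v ^+ K.+2).
  rewrite big_ord_recl big_ord_recr/= [X in _ + (X + _)](_ : _ = u * v * s u v).
    by rewrite /bump /= add1n subn0 subnn beta0 !expr0; ring.
  rewrite /s mulr_sumr; apply: eq_bigr => m _.
  rewrite /bump /= add1n (_ : K.+2 - m.+1 = (K - m).+1)%N; last first.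
    by have := ltn_ord m; lia.
  by rewrite !exprS; ring.
rewrite !S eis_coef_at0 => h.
apply: (mulfI (mulf_neq0 (mulf_neq0 x0 y0) z0)); rewrite mulr0 -[RHS]h.
move: (s x y) (s y z) (s z x) (beta _) => s1 s2 s3 b.
rewrite ![_ ^+ K.+2]exprS; move: (x ^+ _) (y ^+ _) (z ^+ _) => X Y Z.
by field; rewrite x0 y0 z0.
Qed.

Variable n : nat.
Hypothesis n0 : (0 < n)%N.

Let D (f : nat -> rat) : rat := \sum_(1 <= d < n.+1 | (d %| n)%N) f d.

(** The factor 2 on odd degrees is that of e^(du) - e^(-du), summed over the divisors d of l. *)
Let eis_coef_phi j l u : (0 < l)%N -> eis_coef j.+1 l * u ^+ j =
  \sum_(1 <= d < l.+1 | (d %| l)%N) (odd j)%:R * (2 * phi j (d%:R * u)).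
Proof.
move=> l0; rewrite /eis_coef /= (negbTE (lt0n_neq0 l0)); case: ifP => oj.
  by rewrite (negbTE oj) mul0r big1// => d _; rewrite mul0r.
rewrite (negbFE oj) sigmaE// natr_sum -!mulrA mulr_suml mulr_sumr.
by apply: eq_bigr => d _; rewrite natrX /phi exprMn mul1r; ring.
Qed.

Let cross d x u : rat := \sum_(m < K.+1) beta m.+1 * x ^+ m * phi (K - m) (d%:R * u).

Let eisE j u : eis_coef j.+1 n * u ^+ j = D (fun d => (odd j)%:R * (2 * phi j (d%:R * u))).
Proof. exact: eis_coef_phi. Qed.

Let crossE x y :
  \sum_(m < K.+1) eis_coef m.+1 0 * eis_coef (K - m).+1 n * (x ^+ m * y ^+ (K - m)) =
  - 2 * D (fun d => cross d x y).
Proof.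
rewrite /D mulr_sumr; under [RHS]eq_bigr do rewrite /cross mulr_sumr.
rewrite exchange_big/=; apply: eq_bigr => m _.
rewrite eis_coef_at0 mulrACA eisE /D mulr_sumr; apply: eq_bigr => d _.
rewrite oddKm; last by rewrite -ltnS.
by rewrite /beta /=; case: (odd m) => /=; ring.
Qed.

Let crossE' x y :
  \sum_(m < K.+1) eis_coef m.+1 n * eis_coef (K - m).+1 0 * (x ^+ m * y ^+ (K - m)) =
  - 2 * D (fun d => cross d y x).
Proof.
rewrite -crossE (reindex_inj rev_ord_inj)/=; apply: eq_bigr => m _.
rewrite subSS subKn; last by rewrite -ltnS.
by rewrite [eis_coef _ n * _]mulrC [x ^+ _ * _]mulrC.
Qed.

(** [beta_diff] is summed along u_j = d y + j x for 0 <= j <= d, from d y to -d z. The left side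
    telescopes, its term i = 0 giving the quotients by x. The right side is a trapezoidal sum whose
    interior points are (d - j) y - j z. *)
Let cross_hook d x y z : (0 < d)%N -> x + y + z = 0 -> x != 0 ->
  cross d x y + cross d x z =
  - ((phi K.+1 (d%:R * y) + phi K.+1 (d%:R * z)) / x)
  - (phi K (d%:R * y) / 2 + phi K (d%:R * z) / 2 + hook_sum (phi K) d y z).
Proof.
move=> d0 xyz x0.
pose u j := d%:R * y + j%:R * x.
have step j : \sum_(0 <= i < K.+2) beta i * x ^+ i *
     (phi (K.+1 - i) (u j.+1) - phi (K.+1 - i) (u j)) =
     x / 2 * (phi K (u j.+1) + phi K (u j)).
  have -> : u j.+1 = u j + x by rewrite /u -natr1; ring.
  exact: beta_diff.
have : \sum_(0 <= j < d) \sum_(0 <= i < K.+2) beta i * x ^+ i *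
     (phi (K.+1 - i) (u j.+1) - phi (K.+1 - i) (u j)) =
   \sum_(0 <= j < d) x / 2 * (phi K (u j.+1) + phi K (u j)).
  by apply: eq_bigr => j _; exact: step.
rewrite exchange_big/=.
have tel i : \sum_(0 <= j < d) beta i * x ^+ i *
    (phi (K.+1 - i) (u j.+1) - phi (K.+1 - i) (u j)) =
    beta i * x ^+ i * (phi (K.+1 - i) (u d) - phi (K.+1 - i) (u 0)).
  by rewrite -mulr_sumr telescope_sumr.
under eq_bigr do rewrite tel.
have ud : u d = - (d%:R * z) by rewrite /u (_ : z = - (x + y)); [ring | lra].
have u0 : u 0 = d%:R * y by rewrite /u mul0r addr0.
rewrite ud u0.
have -> : \sum_(0 <= i < K.+2) beta i * x ^+ i *
     (phi (K.+1 - i) (- (d%:R * z)) - phi (K.+1 - i) (d%:R * y)) =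
   - (phi K.+1 (d%:R * y) + phi K.+1 (d%:R * z)) - x * (cross d x y + cross d x z).
  rewrite big_mkord big_ord_recl/= beta0 subn0 expr0 mul1r mul1r phi_parity.
  rewrite exprS -signr_odd (negbTE Keven) expr0 mulr1 mulN1r; congr (_ + _); first by ring.
  rewrite /cross -big_split/= mulr_sumr -sumrN; apply: eq_bigr => m _.
  rewrite /bump /= add1n subSS phi_parity -signr_odd oddKm; last by rewrite -ltnS.
  by rewrite /beta /= exprS; case: (odd m) => /=; ring.
have -> : \sum_(0 <= j < d) x / 2 * (phi K (u j.+1) + phi K (u j)) =
   x * (phi K (d%:R * y) / 2 + phi K (d%:R * z) / 2 + hook_sum (phi K) d y z).
  rewrite -mulr_sumr big_split/= -[X in x / 2 * (X + _)](big_add1 _ _ 0 d.+1 xpredT (fun j => phi K (u j))).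
  rewrite big_nat_recr//= ud phi_parity -signr_odd (negbTE Keven) expr0 mul1r.
  rewrite (big_ltn d0) u0.
  have -> : \sum_(1 <= j < d) phi K (u j) = hook_sum (phi K) d y z.
    rewrite /hook_sum !big_nat; apply: eq_bigr => j /andP[_ jd]; congr phi.
    by rewrite /u natrB 1?ltnW// (_ : x = - (y + z)); [ring | lra].
  by field.
move=> h; apply: (mulfI x0); move: h.
move: (cross d x y) (cross d x z) (hook_sum _ _ _ _) => c1 c2 hk h.
have -> : x * (c1 + c2) = - (phi K.+1 (d%:R * y) + phi K.+1 (d%:R * z)) -
  (x * (phi K (d%:R * y) / 2 + phi K (d%:R * z) / 2 + hk)) by rewrite -h; ring.
by field.
Qed.

(** Degree K of (2 sinh p)(2 sinh q) = 2 (cosh(p+q) - cosh(p-q)). *)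
Let odd_part p q :
  \sum_(m < K.+1) ((odd m)%:R * (2 * phi m p)) * ((odd (K - m))%:R * (2 * phi (K - m) q)) =
  2 * (phi K (p + q) - phi K (p - q)).
Proof.
have -> : phi K (p - q) = phi K (q - p).
  by rewrite -[p - q]opprB phi_parity -signr_odd (negbTE Keven) expr0 mul1r.
rewrite [p + q]addrC !phiD !big_mkord -sumrB mulr_sumr; apply: eq_bigr => m _.
rewrite oddKm; last by rewrite -ltnS.
by rewrite phi_parity -signr_odd; case: (odd m) => /=; ring.
Qed.

Let quadE x y :
  \sum_(m < K.+1) (\sum_(1 <= l < n) eis_coef m.+1 l * eis_coef (K - m).+1 (n - l)) *
     (x ^+ m * y ^+ (K - m)) =
  2 * \sum_(1 <= l < n) \sum_(1 <= a < l.+1 | (a %| l)%N)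
        \sum_(1 <= c < (n - l).+1 | (c %| n - l)%N)
     (phi K (a%:R * x + c%:R * y) - phi K (a%:R * x - c%:R * y)).
Proof.
under eq_bigr do rewrite mulr_suml.
rewrite exchange_big/= mulr_sumr !big_nat; apply: eq_bigr => l /andP[l0 ln].
have nl0 : (0 < n - l)%N by rewrite subn_gt0.
under eq_bigr do rewrite mulrACA (eis_coef_phi _ _ l0) (eis_coef_phi _ _ nl0) mulr_suml.
rewrite exchange_big/= mulr_sumr; apply: eq_bigr => a _.
under eq_bigr do rewrite mulr_sumr.
by rewrite exchange_big/= mulr_sumr; apply: eq_bigr => c _; exact: odd_part.
Qed.

Let conv_split a b : conv a b n =
  a 0%N * b n + a n * b 0%N + \sum_(1 <= l < n) a l * b (n - l)%N.
Proof. by rewrite /conv big_nat_recr//= subnn big_ltn// subn0 addrAC. Qed.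

(** Writing n = (n/d) d, the factor d x / K raises [phi K.-1] to [phi K]. The weight n/d is the one
    in [divisor_convolution]. *)
Let derivD x : n%:R * eis_coef K n / K%:R * (x * x ^+ K.-1) =
  D (fun d => 2 * (n %/ d)%:R * phi K (d%:R * x)).
Proof.
have oK : odd K.-1 by case: K K0 Keven => //= L _; rewrite negbK.
have phiS u : phi K u = u / K%:R * phi K.-1 u.
  rewrite /phi -[in LHS](prednK K0) exprS factS natrM prednK//.
  have := fact_neq0 K.-1; have : K%:R != 0 :> rat by rewrite pnatr_eq0 -lt0n.
  by move=> a b; field; rewrite a b.
have := eisE K.-1 x; rewrite prednK// oK => h.
have -> : n%:R * eis_coef K n / K%:R * (x * x ^+ K.-1) =
  n%:R / K%:R * x * (eis_coef K n * x ^+ K.-1) by ring.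
rewrite h /D mulr_sumr; apply: eq_bigr => d dn; rewrite phiS.
have -> : n%:R = (n %/ d)%:R * d%:R :> rat by rewrite -natrM divnK.
rewrite /=; ring.
Qed.

Let DD f g : D f + D g = D (fun d => f d + g d).
Proof. by rewrite /D big_split. Qed.

Let DZ c f : c * D f = D (fun d => c * f d).
Proof. by rewrite /D mulr_sumr. Qed.

Let DB f g : D f - D g = D (fun d => f d - g d).
Proof. by rewrite /D sumrB. Qed.

Let Ddiv f c : D f / c = D (fun d => f d / c).
Proof. by rewrite /D mulr_suml. Qed.

Let D0 f : (forall d, (0 < d)%N -> f d = 0) -> D f = 0.
Proof.
move=> f0; rewrite /D big_nat_cond big1// => d /andP[/andP[d0 _] _].
exact: f0.
Qed.

Lemma eisW_cyclic_pos x y z : x + y + z = 0 -> x != 0 -> y != 0 -> z != 0 ->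
  \sum_(m < K.+1) eisW_coef m.+1 (K - m).+1 n * (x ^+ m * y ^+ (K - m)) +
  \sum_(m < K.+1) eisW_coef m.+1 (K - m).+1 n * (y ^+ m * z ^+ (K - m)) +
  \sum_(m < K.+1) eisW_coef m.+1 (K - m).+1 n * (z ^+ m * x ^+ (K - m)) = 0.
Proof.
move=> xyz x0 y0 z0.
have yzx : y + z + x = 0 by lra.
have zxy : z + x + y = 0 by lra.
have xzy : x + z + y = 0 by lra.
rewrite (splitT n xyz z0) (splitT n yzx x0) (splitT n zxy y0).
have phiKN u : phi K (- u) = phi K u.
  by rewrite phi_parity -signr_odd (negbTE Keven) expr0 mul1r.
pose q u v : rat := \sum_(1 <= l < n) \sum_(1 <= a < l.+1 | (a %| l)%N)
  \sum_(1 <= c < (n - l).+1 | (c %| n - l)%N)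
     (phi K (a%:R * u + c%:R * v) - phi K (a%:R * u - c%:R * v)).
have hq : q x y + q y z + q z x = D (fun d =>
    ((n %/ d)%:R - 1) * (phi K (d%:R * x) + phi K (d%:R * y) + phi K (d%:R * z)) -
    (hook_sum (phi K) d x y + hook_sum (phi K) d y z + hook_sum (phi K) d z x)).
  exact: divisor_convolution.
have cE u v : \sum_(m < K.+1) conv (eis_coef m.+1) (eis_coef (K - m).+1) n *
    (u ^+ m * v ^+ (K - m)) =
  - 2 * D (fun d => cross d u v) + - 2 * D (fun d => cross d v u) + 2 * q u v.
  rewrite -crossE -crossE' -quadE -!big_split/=; apply: eq_bigr => m _.
  by rewrite conv_split !mulrDl.
rewrite !cE.
have hD := derivD; have eD u : eis_coef K.+2 n * u ^+ K.+1 = D (fun d => 2 * phi K.+1 (d%:R * u)).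
  by rewrite eisE /= Keven; apply: eq_bigr => d _; rewrite mul1r.
set e := n%:R * _ / _ in hD *.
set X := x ^+ K.-1 in hD *; set Y := y ^+ K.-1; set Z := z ^+ K.-1.
transitivity (2 * (q x y + q y z + q z x)
  + - 2 * D (fun d => (cross d x y + cross d x z) + (cross d y z + cross d y x) + (cross d z x + cross d z y))
  - (e * (x * X) + e * (y * Y) + e * (z * Z))
  - ((eis_coef K.+2 n * x ^+ K.+1 + eis_coef K.+2 n * y ^+ K.+1) / z
    + (eis_coef K.+2 n * y ^+ K.+1 + eis_coef K.+2 n * z ^+ K.+1) / x
    + (eis_coef K.+2 n * z ^+ K.+1 + eis_coef K.+2 n * x ^+ K.+1) / y)).
  (* Expanding (x + y + z)(X + Y + Z) = 0 trades the mixed products for minus the sum of the K-th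
     powers. *)
  rewrite -!DD; have -> : e * (x * X) + e * (y * Y) + e * (z * Z) =
    - (e * (x * Y + X * y) + e * (y * Z + Y * z) + e * (z * X + Z * x)).
    have -> : x = - (y + z) by lra.
    by ring.
  move: (q x y) (q y z) (q z x) => q1 q2 q3; ring.
move: (q x y) (q y z) (q z x) hq => q1 q2 q3 hq. 
rewrite hq !eD /X /Y /Z !hD !DD !Ddiv !DZ !DD !DB.
(* Everything is now one sum over the divisors d of n, and it vanishes term by term. *)
apply: D0 => d d0.
rewrite (cross_hook d0 xyz x0) (cross_hook d0 yzx y0) (cross_hook d0 zxy z0).
field; rewrite x0 y0 z0//.
Qed.

End CyclicIdentity.

Lemma eisW_cyclic K n (x y z : rat) : (0 < K)%N -> ~~ odd K ->
  x + y + z = 0 -> x != 0 -> y != 0 -> z != 0 ->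
  \sum_(m < K.+1) eisW_coef m.+1 (K - m).+1 n * (x ^+ m * y ^+ (K - m)) +
  \sum_(m < K.+1) eisW_coef m.+1 (K - m).+1 n * (y ^+ m * z ^+ (K - m)) +
  \sum_(m < K.+1) eisW_coef m.+1 (K - m).+1 n * (z ^+ m * x ^+ (K - m)) = 0.
Proof.
by case: n => [|n] K0 oK xyz x0 y0 z0; [exact: eisW_cyclic0 | exact: eisW_cyclic_pos].
Qed.

(** * Extraction of a coefficient in three variables *)

Section CoefficientExtraction.

Lemma poly_nat_eq0 (p : {poly rat}) N :
  (forall i, (N < i)%N -> p.[i%:R] = 0) -> p = 0.
Proof.
move=> h; apply: (@roots_geq_poly_eq0 _ p [seq (N.+1 + i)%:R | i <- iota 0 (size p)]).
- by apply/allP => _ /mapP[i _ ->]; rewrite rootE h// addSn ltnS leq_addr.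
- rewrite map_inj_uniq ?iota_uniq// => i j /eqP; rewrite eqr_nat eqn_add2l.
  by move/eqP.
- by rewrite size_map size_iota.
Qed.

Variables (K : nat) (w : nat -> rat).
Implicit Types U V W x y z : rat.

Let T x y : rat := \sum_(m < K.+1) w m * (x ^+ m * y ^+ (K - m)).

(** The coefficient of U^a V^b W^c in T(U - W, V - U); by homogeneity a = K - b - c is
    determined. *)
Definition bin_coef (b c : nat) : rat :=
  \sum_(m < K.+1) w m * ('C(m, c)%:R * 'C(K - m, b)%:R * (-1) ^+ (c + (K - m - b))).

Let triple (M : nat -> nat -> nat -> rat) U V W : rat :=
  \sum_(a < K.+1) \sum_(b < K.+1) \sum_(c < K.+1)
    (a + b + c == K)%N%:R * M a b c * (U ^+ a * V ^+ b * W ^+ c).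

Let exp_wide n u v : (n <= K)%N ->
  (u + v) ^+ n = \sum_(c < K.+1) 'C(n, c)%:R * (u ^+ (n - c) * v ^+ c) :> rat.
Proof.
move=> nK; rewrite exprDn.
rewrite -(big_mkord xpredT (fun i => u ^+ (n - i) * v ^+ i *+ 'C(n, i))).
rewrite -(big_mkord xpredT (fun c => 'C(n, c)%:R * (u ^+ (n - c) * v ^+ c))).
rewrite [RHS](@big_cat_nat _ _ _ n.+1)//=.
rewrite [X in _ = _ + X]big_nat [X in _ = _ + X]big1 ?addr0; last first.
  by move=> c /andP[nc _]; rewrite bin_small// mul0r.
by apply: eq_bigr => i _; rewrite mulr_natl.
Qed.

Let sum_unique b c (F : nat -> rat) : (b + c <= K)%N ->
  \sum_(a < K.+1) (a + b + c == K)%N%:R * F a = F (K - b - c)%N.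
Proof.
move=> bc; have aK : (K - b - c < K.+1)%N by lia.
rewrite (bigD1 (Ordinal aK))//= big1 ?addr0; last first.
  move=> a aa; rewrite (_ : (_ == _) = false) ?mul0r//.
  by apply: contraNF aa => /eqP h; apply/eqP/val_inj => /=; lia.
by rewrite (_ : (_ == _) = true) ?mul1r//; apply/eqP; lia.
Qed.

Let T_triple U V W : T (U - W) (V - U) = triple (fun _ b c => bin_coef b c) U V W.
Proof.
rewrite /triple exchange_big/=.
transitivity (\sum_(b < K.+1) \sum_(c < K.+1) bin_coef b c * (U ^+ (K - b - c) * V ^+ b * W ^+ c)); last first.
  apply: eq_bigr => b _; rewrite [RHS]exchange_big/=; apply: eq_bigr => c _.
  have [bc|bc] := leqP (b + c) K.
    rewrite -(sum_unique (fun a => bin_coef b c * (U ^+ a * V ^+ b * W ^+ c)) bc).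
    by apply: eq_bigr => a _; rewrite mulrA.
  rewrite [RHS]big1 => [|a _]; last first.
    by rewrite (_ : (_ == _) = false) ?mul0r//; apply/negbTE; lia.
  rewrite /bin_coef big1 ?mul0r// => m _.
  have [mc|mc] := ltnP m c; first by rewrite bin_small// !mul0r mulr0.
  by rewrite ['C(K - m, b)]bin_small ?mulr0 ?mul0r ?mulr0//; have := ltn_ord m; lia.
rewrite /T /bin_coef.
under [RHS]eq_bigr do under eq_bigr do rewrite mulr_suml.
under [RHS]eq_bigr do rewrite exchange_big/=.
rewrite [RHS]exchange_big/=; apply: eq_bigr => m _.
have mK : (m <= K)%N by rewrite -ltnS.
rewrite [V - U]addrC (exp_wide _ _ mK) (exp_wide _ _ (leq_subr m K)).
rewrite [X in w m * X]mulrC mulr_suml mulr_sumr; apply: eq_bigr => b _.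
rewrite !mulr_sumr; apply: eq_bigr => c _.
have [mc|mc] := ltnP m c.
  by rewrite ['C(m, c)]bin_small// !(mul0r, mulr0).
have [mb|mb] := ltnP (K - m) b.
  by rewrite ['C(K - m, b)]bin_small// !(mul0r, mulr0).
rewrite (exprNn U) (exprNn W) exprD (_ : K - b - c = (K - m - b) + (m - c))%N; last lia.
by rewrite (exprD U); ring.
Qed.

Let triple_rot M U V W : triple M V W U = triple (fun a b c => M b c a) U V W.
Proof.
rewrite /triple.
transitivity (\sum_(b < K.+1) \sum_(c < K.+1) \sum_(a < K.+1)
  (a + b + c == K)%N%:R * M b c a * (U ^+ a * V ^+ b * W ^+ c)).
  apply: eq_bigr => b _; apply: eq_bigr => c _; apply: eq_bigr => a _.
  by rewrite [(b + c + a)%N]addnC addnA; ring.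
under eq_bigr do rewrite exchange_big/=.
by rewrite exchange_big.
Qed.

Let tripleD M M' U V W :
  triple M U V W + triple M' U V W = triple (fun a b c => M a b c + M' a b c) U V W.
Proof.
rewrite /triple -big_split/=; apply: eq_bigr => a _.
rewrite -big_split/=; apply: eq_bigr => b _.
by rewrite -big_split/=; apply: eq_bigr => c _; ring.
Qed.

(** Homogeneity allows U = 1. For each integer v > 1 the values u > v kill a polynomial in u, and
    then all v > 1 kill one in v. The inequalities 1 < v < u keep the differences of 1, u, v
    nonzero. *)
Let triple_eq0 M a b c : (a + b + c = K)%N ->
  (forall v u : nat, (1 < v < u)%N -> triple M 1 u%:R v%:R = 0) -> M a b c = 0.
Proof.
move=> abcK h.
pose G b v : rat := \sum_(c < K.+1) (\sum_(a < K.+1) (a + b + c == K)%N%:R * M a b c) * v ^+ c.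
have tE u v : triple M 1 u v = (\poly_(b < K.+1) G b v).[u].
  rewrite horner_poly /triple exchange_big/=; apply: eq_bigr => b' _.
  rewrite exchange_big/= mulr_suml; apply: eq_bigr => c' _.
  rewrite !mulr_suml; apply: eq_bigr => a' _.
  by rewrite expr1n; ring.
have bK : (b < K.+1)%N by lia.
have cK : (c < K.+1)%N by lia.
have G0 (v : nat) : (1 < v)%N -> G b v%:R = 0.
  move=> v1; have : \poly_(b < K.+1) G b v%:R = 0.
    by apply: (@poly_nat_eq0 _ v) => u vu; rewrite -tE h// v1.
  by move/polyP/(_ b); rewrite coef_poly bK coef0.
have : \poly_(c < K.+1) (\sum_(a < K.+1) (a + b + c == K)%N%:R * M a b c) = 0.
  by apply: (@poly_nat_eq0 _ 1) => v v1; rewrite horner_poly -[RHS](G0 v).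
move/polyP/(_ c); rewrite coef_poly cK coef0 (sum_unique (fun a => M a b c)).
  by rewrite (_ : K - b - c = a)%N//; lia.
lia.
Qed.

Lemma bin_coef_cyclic a b c : (a + b + c = K)%N ->
  (forall x y z, x + y + z = 0 -> x != 0 -> y != 0 -> z != 0 -> T x y + T y z + T z x = 0) ->
  bin_coef b c + bin_coef c a + bin_coef a b = 0.
Proof.
move=> abcK hT.
apply: (@triple_eq0 (fun a b c => bin_coef b c + bin_coef c a + bin_coef a b) _ _ _ abcK).
move=> v u /andP[v1 vu].
have d0 (i j : nat) : i != j -> i%:R - j%:R != 0 :> rat.
  by rewrite subr_eq0 eqr_nat.
(* Rotating (U, V, W) carries (x, y) to (y, z) and then to (z, x), so the three terms are one form
   with rotated exponents. *)
have -> : triple (fun a b c => bin_coef b c + bin_coef c a + bin_coef a b) 1 u%:R v%:R =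
   T (1 - v%:R) (u%:R - 1) + T (u%:R - 1) (v%:R - u%:R) + T (v%:R - u%:R) (1 - v%:R).
  rewrite !T_triple (triple_rot _ 1 u%:R v%:R).
  by rewrite (triple_rot _ u%:R v%:R 1) (triple_rot _ 1 u%:R v%:R) !tripleD.
apply: hT; first by ring.
- by apply: (d0 1%N); lia.
- by apply: (d0 _ 1%N); lia.
- by apply: d0; lia.
Qed.

End CoefficientExtraction.

(** * Conclusion *)

Section Assembly.

Let pair_sum (V : nmodType) K (F : nat -> nat -> V) :
  \sum_(1 <= i < K.+2) \sum_(1 <= j < K.+2 | (i + j == K.+2)%N) F i j =
  \sum_(m < K.+1) F m.+1 (K - m).+1.
Proof.
rewrite big_add1 /= big_mkord; apply: eq_bigr => m _.
have mK := ltn_ord m.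
rewrite big_mkcond (bigD1_seq (K - m).+1) ?mem_index_iota ?iota_uniq//=; last by lia.
rewrite (_ : (_ == _) = true); last by apply/eqP; lia.
rewrite big1 ?addr0// => j jm.
by rewrite (_ : (_ == _) = false)//; apply/negbTE; lia.
Qed.

Definition eis_sum (k r s t : nat) (W : nat -> nat -> rat) : rat :=
  \sum_(1 <= i < k) \sum_(1 <= j < k | (i + j == k)%N)
    'C(i.-1, t.-1)%:R * 'C(j.-1, s.-1)%:R * (-1) ^+ (i + r) * W i j.

Let eis_sum_bin K a b c (W : nat -> nat -> rat) : (a + b + c = K)%N ->
  eis_sum K.+2 a.+1 b.+1 c.+1 W = bin_coef K (fun m => W m.+1 (K - m).+1) b c.
Proof.
move=> abc; rewrite /eis_sum pair_sum; apply: eq_bigr => m _ /=.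
rewrite mulrC; congr (_ * _).
have [mb|mb] := ltnP (K - m) b.
  by rewrite ['C(K - m, b)]bin_small// !(mulr0, mul0r).
(* As b <= K - m here, c + (K - m - b) is a true difference, and a + b + c = K makes it congruent to
   m + a modulo 2. *)
congr (_ * _); rewrite -signr_odd -[RHS]signr_odd; congr (_ ^+ _); congr nat_of_bool.
have := ltn_ord m; lia.
Qed.

(** One of i, j is odd, which kills the product; in a derivative term the index 2 forces the other
    index to be odd. *)
Let eisW_coef_odd i j n : odd (i + j) -> eisW_coef i j n = 0.
Proof.
move=> oij; have z l : odd l -> eis_coef l =1 (fun=> 0).
  by move=> ol m; rewrite /eis_coef ol.
rewrite /eisW_coef (z _ oij) mulr0 subr0 /eisP_coef.
have -> : conv (eis_coef i) (eis_coef j) n = 0.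
  rewrite /conv big1// => l _; move: oij; rewrite oddD.
  case: (boolP (odd i)) => [oi|_] /=; first by rewrite (z _ oi) mul0r.
  by move=> oj; rewrite (z _ oj) mulr0.
have d u v : odd (u + v) -> (u == 2%N)%:R * (n%:R * eis_coef v n / v%:R) = 0 :> rat.
  case: eqP => [->|_]; last by rewrite mul0r.
  by rewrite oddD /= => ov; rewrite (z _ ov) mulr0 mul0r mulr0.
by rewrite (d _ _ oij) d ?addr0// addnC.
Qed.

Lemma eisW_sum_cyclic (r s t k n : nat) : (1 <= r)%N -> (1 <= s)%N -> (1 <= t)%N ->
  k = (r + s + t - 1)%N -> (3 <= k)%N ->
  eis_sum k r s t (fun i j => eisW_coef i j n) +
  eis_sum k s t r (fun i j => eisW_coef i j n) +
  eis_sum k t r s (fun i j => eisW_coef i j n) = 0.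
Proof.
case: r s t => [|a] [|b] [|c]// _ _ _ kE k3.
have [K kK] : exists K, k = K.+2 by exists k.-2; lia.
rewrite kK in kE k3 *.
have abc : (a + b + c = K)%N by lia.
have [oK|oK] := boolP (odd K).
  have z r s t : eis_sum K.+2 r s t (fun i j => eisW_coef i j n) = 0.
    rewrite /eis_sum big1// => i _; rewrite big1// => j /eqP ij.
    by rewrite eisW_coef_odd ?mulr0// ij /= negbK.
  by rewrite !z !addr0.
rewrite !eis_sum_bin; [|lia..].
apply: (@bin_coef_cyclic _ _ a b c abc) => x y z xyz x0 y0 z0.
by apply: eisW_cyclic => //; lia.
Qed.

Variable R : realType.

Lemma eisensteinP_qexp (i j : nat) (tau : R[i]) : (0 < i)%N -> (0 < j)%N ->
  0 < complex.Im tau -> qexp (qpar tau) (eisP_coef i j) (eisensteinP i j tau).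
Proof.
move=> i0 j0 t0.
have ei := eisenstein_qexp i0 t0; have ej := eisenstein_qexp j0 t0.
have dexp l : (0 < l)%N -> qexp (qpar tau) (fun n => n%:R * eis_coef l n)
    (qderiv (@eisenstein R l) tau).
  move=> l0; apply: (qexp_deriv (poly_growth_eis_coef l) _ t0) => t tt0.
  exact: eisenstein_qexp.
have h := qexpM (poly_growth_eis_coef i) (poly_growth_eis_coef j) (cabs_qpar_lt1 t0) ei ej.
have hi := @qexpZ R _ _ _ ((i == 2%N)%:R / j%:R) (dexp j j0).
have hj := @qexpZ R _ _ _ ((j == 2%N)%:R / i%:R) (dexp i i0).
have -> : eisensteinP i j tau = eisenstein i tau * eisenstein j tau +
   ratr ((i == 2%N)%:R / j%:R) * qderiv (@eisenstein R j) tau +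
   ratr ((j == 2%N)%:R / i%:R) * qderiv (@eisenstein R i) tau.
  rewrite /eisensteinP !fmorph_div/= !ratr_nat.
  by rewrite -[X in _ = _ + X + _]mulrA -[X in _ = _ + X]mulrA ![_^-1 * _]mulrC.
apply: eq_qexp (qexpD (qexpD h hi) hj) => n.
by rewrite /eisP_coef; congr (_ + _ + _); ring.
Qed.

Lemma eis_sum_qexp (k r s t : nat) (tau : R[i]) : 0 < complex.Im tau ->
  qexp (qpar tau) (fun n => eis_sum k r s t (fun i j => eisW_coef i j n))
    (\sum_(1 <= i < k) \sum_(1 <= j < k | (i + j == k)%N)
        'C(i.-1, t.-1)%:R * 'C(j.-1, s.-1)%:R * (-1) ^+ (i + r)
          * (eisensteinP i j tau - (-1) ^+ j * eisenstein (i + j) tau)).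
Proof.
move=> t0; rewrite /eis_sum.
rewrite [X in qexp _ _ X]big_nat_cond.
under eq_fun do rewrite big_nat_cond.
apply: qexp_sum => i /andP[/andP[i0 _] _].
rewrite [X in qexp _ _ X]big_nat_cond.
under eq_fun do rewrite big_nat_cond.
apply: qexp_sum => j /andP[/andP[j0 _] _].
have ij0 : (0 < i + j)%N by rewrite addn_gt0 i0.
have h := qexpD (eisensteinP_qexp i0 j0 t0)
  (@qexpZ R _ _ _ (- (-1) ^+ j) (eisenstein_qexp ij0 t0)).
have := @qexpZ R _ _ _ ('C(i.-1, t.-1)%:R * 'C(j.-1, s.-1)%:R * (-1) ^+ (i + r)) h.
rewrite !rmorphM rmorphN !rmorphXn/= rmorphN1 !ratr_nat mulNr.
by apply: eq_qexp => n; rewrite /eisW_coef mulNr.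
Qed.

End Assembly.

Theorem theorem1 (R : realType) (r s t k : nat)
    (hr : (1 <= r)%N) (hs : (1 <= s)%N) (ht : (1 <= t)%N)
    (hk : k = (r + s + t - 1)%N) (hk3 : (3 <= k)%N)
    (tau : R[i]) (htau : 0 < complex.Im tau) :
  0 = \sum_(1 <= i < k) \sum_(1 <= j < k | (i + j == k)%N)
        'C(i.-1, t.-1)%:R * 'C(j.-1, s.-1)%:R * (-1) ^+ (i + r)
          * (eisensteinP i j tau - (-1) ^+ j * eisenstein (i + j) tau)
    + \sum_(1 <= j < k) \sum_(1 <= h < k | (j + h == k)%N)
        'C(j.-1, r.-1)%:R * 'C(h.-1, t.-1)%:R * (-1) ^+ (j + s)
          * (eisensteinP j h tau - (-1) ^+ h * eisenstein (j + h) tau)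
    + \sum_(1 <= h < k) \sum_(1 <= i < k | (h + i == k)%N)
        'C(h.-1, s.-1)%:R * 'C(i.-1, r.-1)%:R * (-1) ^+ (h + t)
          * (eisensteinP h i tau - (-1) ^+ i * eisenstein (h + i) tau).
Proof.
have := qexpD (qexpD (@eis_sum_qexp R k r s t tau htau) (@eis_sum_qexp R k s t r tau htau))
  (@eis_sum_qexp R k t r s tau htau).
(* The expansion of the total is the zero sequence, so the total is a limit of zero partial sums. *)
move/(eq_qexp (fun n => eisW_sum_cyclic n hr hs ht hk hk3)).
exact: qexp_unique (qexp0 _).
Qed.
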